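(* Let $F$ be a strictly 1-balanced graph with $s>0$ edges on $r\ge 2$ vertices. Given $c>0$, let $p=c\,n^{-1/\mathrm{d}_1(F)}$ and $q=p^s=c^s n^{1-r}$. Then there exists a constant $m(F,c)$ (deterministic, depending only on $F$ and $c$) such that $$\frac{\mathrm{MinM}(\mathbb{G}(n,p),F)}{n}\to m(F,c)$$ with high probability as $n\to\infty$ (i.e. in probability).
   Context: For a graph $G$ with at least two vertices, $\mathrm{d}_1(G)=\frac{|E(G)|}{|V(G)|-1}$. A graph $F$ is strictly 1-balanced if $\mathrm{d}_1(F')<\mathrm{d}_1(F)$ for every subgraph $F'\neq F$ of $F$ (with at least two vertices). $\mathbb{G}(n,p)$ is the Erdős–Rényi random graph on vertex set $[n]=\{1,\dots,n\}$ in which each edge is present independently with probability $p$. For a graph $G=(V,E)$ and a bipartition $V=V_1\cup V_2$, $V_1\cap V_2=\emptyset$ (equivalently a 2-coloring of $V$), a subgraph of $G$ isomorphic to $F$ (not necessarily induced) is monochromatic if its vertex set is contained entirely in $V_1$ or entirely in $V_2$. $\mathrm{MinM}(G,F)$ denotes the minimum, over all bipartitions of $V$, of the number of monochromatic subgraphs of $G$ isomorphic to $F$. *)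

(* Defs.v *)
From HB Require Import structures.
From mathcomp Require Import all_boot all_order all_algebra.
From mathcomp Require Import all_classical all_reals all_analysis.

Set Implicit Arguments.
Unset Strict Implicit.
Unset Printing Implicit Defensive.

Import Order.TTheory GRing.Theory Num.Theory.
Import numFieldNormedType.Exports.

Local Open Scope ring_scope.

(* Finite simple graphs whose vertices are taken in an ambient finite type:
   the vertex set need not be the whole type, so that a graph and its
   subgraphs live in the same type. *)
Definition is_graph (T : finType) (g : {set T} * {set {set T}}) : bool :=
  [forall e in g.2, (e \subset g.1) && (#|e| == 2%N)].

Record graph (T : finType) := Graph {
  graph_val : {set T} * {set {set T}};
  _ : is_graph graph_val }.

HB.instance Definition _ (T : finType) := [isSub for @graph_val T].
HB.instance Definition _ (T : finType) := [Finite of graph T by <:].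

Definition vertices (T : finType) (G : graph T) : {set T} := (graph_val G).1.
Definition edges (T : finType) (G : graph T) : {set {set T}} :=
  (graph_val G).2.

Definition subgraph (T : finType) (H G : graph T) : bool :=
  (vertices H \subset vertices G) && (edges H \subset edges G).

(* Only the restriction of f to the vertices of G matters. *)
Definition isomorphic (T U : finType) (G : graph T) (H : graph U) : bool :=
  [exists f : {ffun T -> U},
    [&& dinjectiveb f (vertices G), f @: vertices G == vertices H
      & [set f @: (e : {set T}) | e in edges G] == edges H]].

(* Meaningful for graphs with at least two vertices. *)
Definition d1 (T : finType) (G : graph T) : rat :=
  #|edges G|%:R / (#|vertices G|.-1)%:R.

Definition strictly_1_balanced (T : finType) (F : graph T) : Prop :=
  forall F' : graph T, subgraph F' F -> F' != F ->
    (2 <= #|vertices F'|)%N -> d1 F' < d1 F.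

Definition is_bipartition (T : finType) (G : graph T)
    (P : {set T} * {set T}) : bool :=
  (P.1 :|: P.2 == vertices G) && (P.1 :&: P.2 == finset.set0).

Definition monochromatic (T : finType) (P : {set T} * {set T})
    (H : graph T) : bool :=
  (vertices H \subset P.1) || (vertices H \subset P.2).

Definition num_mono (T U : finType) (G : graph U) (F : graph T)
    (P : {set U} * {set U}) : nat :=
  #|[set H : graph U |
      [&& subgraph H G, isomorphic F H & monochromatic P H]]|.

Definition MinM (T U : finType) (G : graph U) (F : graph T) : nat :=
  num_mono G F
    [arg min_(P < (vertices G, finset.set0) | is_bipartition G P)
       num_mono G F P].

(* The mass function of the random graph G(n,p), with ['I_n] as vertex set;
   it is a probability distribution when [0 <= p <= 1]. *)
Definition gnp (R : realType) (n : nat) (p : R) (G : graph 'I_n) : R :=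
  if vertices G == [set: 'I_n]%SET then
    \prod_(e : {set 'I_n} | #|e| == 2%N) (if e \in edges G then p else 1 - p)
  else 0.

Definition gnp_prob (R : realType) (n : nat) (p : R)
    (A : pred (graph 'I_n)) : R :=
  \sum_(G : graph 'I_n | A G) gnp p G.

Lemma gnp_ge0 (R : realType) (n : nat) (p : R) (G : graph 'I_n) :
  0 <= p <= 1 -> 0 <= gnp p G.
Proof.
move=> /andP[p0 p1]; rewrite /gnp; case: ifP => // _.
by apply: prodr_ge0 => e _; case: ifP => // _; rewrite subr_ge0.
Qed.

Lemma gnp_prob_predT (R : realType) (n : nat) (p : R) :
  gnp_prob p (predT : pred (graph 'I_n)) = 1.
Proof.
pose pairs : {set {set 'I_n}} := [set e : {set 'I_n} | #|e| == 2%N]%SET.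
have gP (E : {set {set 'I_n}}) : is_graph ([set: 'I_n]%SET, E :&: pairs).
  by apply/forall_inP => e /=; rewrite !inE finset.subsetT => /andP[].
rewrite /gnp_prob /gnp -big_mkcond /=.
rewrite (reindex_onto (fun E => Graph (gP E)) (@edges _)) /=; last first.
  move=> G /eqP VG; apply: val_inj => /=; case: G VG => -[V E] gE VG.
  congr pair; first by rewrite -VG.
  apply/finset.setIidPl/fintype.subsetP => e eE; rewrite inE.
  by have /forall_inP/(_ e eE)/andP[] := gE.
pose f e : R := if e \in pairs then p else 0.
pose g e : R := if e \in pairs then 1 - p else 1.
transitivity (\prod_e (f e + g e)); last first.
  rewrite big1 // => e _; rewrite /f /g; case: ifP => _; last by rewrite add0r.
  by rewrite addrC subrK.
rewrite bigA_distr /= big_mkcond [RHS]big_mkcond /=; apply: eq_bigr => E _.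
rewrite /vertices /edges /= eqxx /=.
have [/finset.setIidPl EP|/fintype.subsetPn[e eE eP]] := boolP (E \subset pairs).
  rewrite EP eqxx big_mkcond /=; apply: eq_bigr => e _.
  rewrite /f /g inE; case: ifP => // e2; case: ifP => // eE.
  by move: eE; rewrite -EP !inE e2 andbF.
have -> : (E :&: pairs == E) = false.
  apply/negP => /eqP/finset.setIidPl/fintype.subsetP/(_ e eE).
  exact/negP.
by rewrite (bigD1 e) //= eE /f (negPf eP) mul0r.
Qed.

(* For the finitely many n where this exceeds 1, [gnp] is not a probability;
   this does not affect limits as n grows. *)
Definition edge_prob (R : realType) (T : finType) (F : graph T) (c : R)
    (n : nat) : R :=
  c * n%:R `^ (- (1 / ratr (d1 F))).

(* Main.v *)
(* The copies of F in G(n,p) are compared with independent hyperedges of the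
   same probability q = p^s, by exchanging the indicators one at a time. An
   exchange costs at most the expected number of copies that overlap a given one
   in an edge and get completed by it; strict 1-balancedness makes this
   O(n^(-1/s)). As about n copies are expected, the mean of any (1/n)-Lipschitz
   function of the set of copies, in particular |MinM/n - m|, is the same in both
   models up to O(n^(-1/s)).

   For independent hyperedges the minimum concentrates around its mean a(n) by
   the Efron-Stein inequality. Interpolating between hyperedges spread over the
   whole vertex set and hyperedges inside k parts of size n, the derivative
   compares the numbers of r-sets that are monochromatic in all optimal
   colourings, i.e. lie inside the classes of an equivalence relation; convexity
   of x^r decides its sign and yields a(kn) <= k (a(n) + O(1)). Hence a(n)/n
   converges. *)
Require Import Defs.
From HB Require Import structures.
From mathcomp Require Import all_boot all_order all_algebra.
From mathcomp Require Import all_classical all_reals all_analysis.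
From mathcomp Require Import ring lra zify polyrcf.
Set Implicit Arguments.
Unset Strict Implicit.
Unset Printing Implicit Defensive.
Import Order.TTheory GRing.Theory Num.Theory.
Import numFieldNormedType.Exports.
Local Open Scope ring_scope.

(** * Product Bernoulli measures *)

(** The random graph itself resists a subadditivity argument: cutting the vertex set destroys the
    copies that straddle the parts, and copies sharing an edge are dependent. With independent
    hyperedges each probability can be moved separately; the mean minimum is a polynomial in them,
    and its partial derivative at [j] is the mean effect of adding [j]. For [j] outside [Y] this
    effect is 1 or 0 according to whether every optimal colouring of [Y] leaves [j] monochromatic.
    If [j] is already in [Y], this description may fail, by at most 1 and with the probability of
    [j]; the loss is a sum of squared probabilities, of order n^(2-r) per part. As r >= 2 it is
    bounded, like the loss in replacing falling factorials by powers, and a bounded loss D per part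
    only makes the candidate limit the infimum of (a(n) + D)/n. The exponent 1/s comes from
    integrality: strict balance is a strict inequality between integers, hence has a gap of 1, and
    [p] is [c] divided by an integral power of n^(1/s). In the random graph only means are compared;
    Markov's inequality turns them into probabilities. *)

Section BernoulliRing.
Variables (R : comNzRingType) (J : finType).
Implicit Types (q : J -> R) (g : {set J} -> R) (Y Z A : {set J}) (i j : J).

(** The values lie in a commutative ring rather than a field so that [q j] may also be a polynomial,
    which is how probabilities are moved along a segment. *)
Definition bern q Y : R := \prod_j (if j \in Y then q j else 1 - q j).

Definition Ex q g : R := \sum_Y bern q Y * g Y.

Definition bern_but j q Y : R :=
  \prod_(i | i != j) (if i \in Y then q i else 1 - q i).

Lemma sum_set_split j (G : {set J} -> R) :
  \sum_Y G Y = \sum_(Y : {set J} | j \notin Y) (G (j |: Y) + G Y).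
Proof.
rewrite (bigID (fun Y : {set J} => j \in Y)) /= big_split /=; congr (_ + _).
rewrite (reindex_onto (fun Y => j |: Y) (fun Y => Y :\ j)) /=; last first.
  by move=> Y jY; rewrite finset.setD1K.
apply: eq_bigl => Y; rewrite setU11 /=.
apply/eqP/idP => [<-|jY]; first by rewrite !inE eqxx.
by rewrite setU1K.
Qed.

Lemma bernU1 j q Y : bern q (j |: Y) = q j * bern_but j q Y.
Proof.
rewrite /bern (bigD1 j) //= setU11; congr (_ * _).
by apply: eq_bigr => i /negPf ij; rewrite !inE ij.
Qed.

Lemma bernD1 j q Y : j \notin Y -> bern q Y = (1 - q j) * bern_but j q Y.
Proof. by move=> /negPf jY; rewrite /bern (bigD1 j) //= jY. Qed.

Lemma Ex_split j q g : Ex q g =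
  \sum_(Y : {set J} | j \notin Y)
    bern_but j q Y * (q j * g (j |: Y) + (1 - q j) * g Y).
Proof.
rewrite /Ex (sum_set_split j); apply: eq_bigr => Y jY.
by rewrite bernU1 (bernD1 _ jY); ring.
Qed.

Lemma setU1D1 j Y : j |: (Y :\ j) = j |: Y.
Proof. by apply/finset.setP => i; rewrite !inE; case: eqP. Qed.

Lemma setU1U1 j Y : j |: (j |: Y) = j |: Y.
Proof. by rewrite finset.setUA finset.setUid. Qed.

Lemma setD1_id j Y : j \notin Y -> Y :\ j = Y.
Proof.
move=> jY; apply/finset.setP => i; rewrite !inE.
by case: eqP => [->|]; rewrite ?(negPf jY).
Qed.

Lemma eq_Ex q g g' : g =1 g' -> Ex q g = Ex q g'.
Proof. by move=> gg; apply: eq_bigr => Y _; rewrite gg. Qed.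

Arguments eq_Ex {q g} g' _.

Lemma eq_ExP q g g' :
  (forall Y, (forall j, j \in Y -> q j != 0) -> g Y = g' Y) ->
  Ex q g = Ex q g'.
Proof.
move=> gg; apply: eq_bigr => Y _.
have [/forallP Yq|] := boolP [forall j, (j \in Y) ==> (q j != 0)].
  by rewrite gg // => j jY; apply: (implyP (Yq j)).
rewrite negb_forall => /existsP[j]; rewrite negb_imply negbK => /andP[jY /eqP q0].
by rewrite /bern (bigD1 j) //= jY q0 !mul0r.
Qed.

Lemma ExD q g g' : Ex q (fun Y => g Y + g' Y) = Ex q g + Ex q g'.
Proof. by rewrite /Ex -big_split; apply: eq_bigr => Y _; rewrite mulrDr. Qed.

Lemma ExZ q (x : R) g : Ex q (fun Y => x * g Y) = x * Ex q g.
Proof. by rewrite /Ex big_distrr; apply: eq_bigr => Y _ /=; rewrite mulrCA. Qed.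

Lemma ExB q g g' : Ex q (fun Y => g Y - g' Y) = Ex q g - Ex q g'.
Proof.
rewrite -[- Ex q g']mulN1r -ExZ -ExD; apply: eq_Ex => Y.
by rewrite mulN1r.
Qed.

Lemma Ex_sum (I : finType) (P : pred I) q (g : I -> {set J} -> R) :
  Ex q (fun Y => \sum_(i | P i) g i Y) = \sum_(i | P i) Ex q (g i).
Proof.
rewrite /Ex exchange_big /=; apply: eq_bigr => Y _.
by rewrite big_distrr.
Qed.

(** The sign times [bern_but j q Y] is the derivative of [bern q Y] in [q j], so both sides are the
    partial derivative of the mean of [g]. *)
Lemma Ex_diff j q g :
  Ex q (fun Y => g (j |: Y) - g (Y :\ j)) =
  \sum_(Y : {set J}) (if j \in Y then 1 else -1) * bern_but j q Y * g Y.
Proof.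
rewrite (Ex_split j) (sum_set_split j); apply: eq_bigr => Y jY.
rewrite setU11 (negPf jY) setU1U1 setU1K // setD1_id //.
have -> : bern_but j q (j |: Y) = bern_but j q Y.
  by apply: eq_bigr => i /negPf ij; rewrite !inE ij.
by ring.
Qed.

Lemma Ex_avg1 j q g : Ex q g =
  q j * Ex q (fun Y => g (j |: Y)) + (1 - q j) * Ex q (fun Y => g (Y :\ j)).
Proof.
rewrite !(Ex_split j) !big_distrr -big_split; apply: eq_bigr => Y jY /=.
by rewrite setU1U1 setU1K // setD1_id //; ring.
Qed.

Lemma Ex_ind1 j q (u w : {set J} -> R) :
  (forall Y, u (j |: Y) = u Y) -> (forall Y, w (j |: Y) = w Y) ->
  Ex q (fun Y => if j \in Y then u Y else w Y) =
  Ex q (fun Y => q j * u Y + (1 - q j) * w Y).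
Proof.
move=> uj wj; rewrite !(Ex_split j); apply: eq_bigr => Y jY /=.
by rewrite setU11 (negPf jY) uj wj; ring.
Qed.

Lemma Ex_subset (S : {set J}) q g :
  Ex q (fun Y => (S \subset Y)%:R * g Y) =
  (\prod_(j in S) q j) * Ex q (fun Y => g (S :|: Y)).
Proof.
have [n] := ubnP #|S|; elim: n S g => // n IHn S g Sn.
have [->|[j jS]] := finset.set_0Vmem S.
  by rewrite big_set0 mul1r; apply: eq_Ex => Y; rewrite finset.sub0set mul1r
    finset.set0U.
rewrite (Ex_avg1 j) [X in _ + _ * X](eq_Ex (fun=> 0 * 0)); last first.
  move=> Y; suff /negPf -> : ~~ (S \subset Y :\ j) by rewrite !mul0r.
  by apply/fintype.subsetPn; exists j; rewrite // !inE eqxx.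
rewrite ExZ mul0r mulr0 addr0 (big_setD1 j) //= -mulrA; congr (_ * _).
have SE : S = j |: (S :\ j) by rewrite finset.setD1K.
rewrite (eq_Ex (fun Y => (S :\ j \subset Y)%:R * g (j |: Y))).
  rewrite IHn; last by move: Sn; rewrite (cardsD1 j S) jS.
  by congr (_ * _); apply: eq_Ex => Y; rewrite [in RHS]SE finset.setUA.
by move=> Y; rewrite subDset.
Qed.

Definition splice A Z Y := (Z :&: A) :|: (Y :\: A).

(** Conditional expectation given the coordinates in [A], read off from [Z]. It also serves as a
    hybrid of two models: [Z] may come from a different random source than the averaged
    coordinates. *)
Definition cond_exp q g A Z := Ex q (fun Y => g (splice A Z Y)).

Lemma cond_expU1 j q g A Z : cond_exp q g (j |: A) Z =
  if j \in Z then cond_exp q (fun Y => g (j |: Y)) A Z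
  else cond_exp q (fun Y => g (Y :\ j)) A Z.
Proof.
case: ifPn => jZ; apply: eq_Ex => Y; congr g; apply/finset.setP => i;
  rewrite !inE; case: eqP => [->|] //=; rewrite ?jZ ?(negPf jZ) //=.
Qed.

Lemma cond_exp_avg j q g A Z : j \notin A -> cond_exp q g A Z =
  q j * cond_exp q (fun Y => g (j |: Y)) A Z
  + (1 - q j) * cond_exp q (fun Y => g (Y :\ j)) A Z.
Proof.
move=> jA; rewrite /cond_exp (Ex_avg1 j); congr (_ * _ + _ * _);
  apply: eq_Ex => Y; congr g; apply/finset.setP => i;
  by rewrite !inE; case: eqP => [->|] //=; rewrite ?(negPf jA) ?andbF.
Qed.

Lemma cond_exp_ind j q g A Z : j \notin A -> cond_exp q g A (j |: Z) = cond_exp q g A Z.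
Proof.
move=> jA; apply: eq_Ex => Y; congr g; apply/finset.setP => i.
by rewrite !inE; case: eqP => [->|] //=; rewrite ?(negPf jA) ?andbF.
Qed.

Lemma cond_exp0 q g Z : cond_exp q g finset.set0 Z = Ex q g.
Proof.
by apply: eq_Ex => Y; rewrite /splice finset.setI0 finset.set0U finset.setD0.
Qed.

End BernoulliRing.

Arguments eq_Ex {R J q g} g' _.

Lemma Ex_preim (R : comNzRingType) (J J' : finType) (f : J' -> J) (q : J -> R)
    (g : {set J'} -> R) :
  injective f -> Ex q (fun Y => g (f @^-1: Y)) = Ex (q \o f) g.
Proof.
move=> finj.
rewrite /Ex (partition_big (fun Y : {set J} => f @^-1: Y) predT) //=.
apply: eq_bigr => Z _.
rewrite (eq_bigr (fun Y => bern q Y * g Z)); last by move=> Y /eqP ->.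
rewrite -big_distrl /=; congr (_ * _).
(* [a j] and [b j] are the weights of having [j] in [Y] and out of [Y], set to 0 where that would
   contradict [f @^-1: Y = Z]. Off the range of [f] they add up to 1. *)
pose a j := if j \in f @: Z then q j
            else if j \in f @: [set: J']%SET then 0 else q j.
pose b j := if j \in f @: Z then 0 else 1 - q j.
transitivity (\prod_j (a j + b j)).
  rewrite bigA_distr big_mkcond; apply: eq_bigr => Y _ /=.
  case: eqP => [YZ|/eqP]; [apply: eq_bigr => j _ | rewrite finset.eqEsubset negb_and].
    rewrite /a /b -YZ; case: ifPn => jY; case: imsetP => //.
      by move=> nj; case: imsetP => // -[z _ jz]; case: nj; exists z;
         rewrite // inE -jz.
    by move=> [z]; rewrite inE => zY jz; rewrite jz zY in jY.
  case/orP => /fintype.subsetPn[z].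
    rewrite inE => zY zZ; rewrite (bigD1 (f z)) //= zY /a.
    by rewrite (mem_imset _ _ finj) (negPf zZ) (mem_imset _ _ finj) inE mul0r.
  rewrite inE => zZ zY; rewrite (bigD1 (f z)) //= (negPf zY) /b.
  by rewrite (mem_imset _ _ finj) zZ mul0r.
rewrite (bigID (mem (f @: [set: J']%SET))) /= [X in _ * X]big1 ?mulr1; last first.
  move=> j jf; rewrite /a /b (negPf jf); case: ifPn => [|_].
    by case/imsetP => z _ jz; rewrite jz mem_imset ?inE // in jf.
  by rewrite addrC subrK.
rewrite big_imset /=; last by move=> x y _ _; apply: finj.
apply: eq_big => [z|z _]; first by rewrite inE.
rewrite /a /b !(mem_imset _ _ finj) inE; case: ifP => _; first by rewrite addr0.
by rewrite add0r.
Qed.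

Section BernoulliOrdered.
Variables (R : realFieldType) (J : finType) (q : J -> R).
Hypothesis q01 : forall j, 0 <= q j <= 1.
Implicit Types (g : {set J} -> R) (Y Z A : {set J}) (i j : J).

Lemma bern_ge0 Y : 0 <= bern q Y.
Proof.
apply: prodr_ge0 => j _; have /andP[? ?] := q01 j.
by case: ifP => // _; rewrite subr_ge0.
Qed.

Lemma Ex_le g g' : (forall Y, g Y <= g' Y) -> Ex q g <= Ex q g'.
Proof. by move=> gg; apply: ler_sum => Y _; rewrite ler_wpM2l ?bern_ge0. Qed.

Lemma Ex_norm g : `|Ex q g| <= Ex q (fun Y => `|g Y|).
Proof.
apply: le_trans (ler_norm_sum _ _ _) _; apply: ler_sum => Y _.
by rewrite normrM ger0_norm ?bern_ge0.
Qed.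

End BernoulliOrdered.

Lemma Ex_const (R : comNzRingType) (J : finType) (q : J -> R) (x : R) :
  Ex q (fun=> x) = x.
Proof.
rewrite /Ex -big_distrl /=; have -> : \sum_(Y : {set J}) bern q Y = 1; last by
  rewrite mul1r.
transitivity (\prod_j (q j + (1 - q j))); first by rewrite bigA_distr.
by rewrite big1 // => j _; rewrite addrC subrK.
Qed.

Lemma telescope_set (R : numDomainType) (J : finType) (V : {set J} -> R)
    (w : J -> R) :
  (forall j (A : {set J}), j \notin A -> V (j |: A) - V A <= w j) ->
  V [set: J]%SET - V finset.set0 <= \sum_j w j.
Proof.
move=> Vw; suff H n (A : {set J}) : #|A| = n ->
    V A - V finset.set0 <= \sum_(j in A) w j.
  apply: le_trans (H _ _ erefl) _.
  by rewrite (eq_bigl predT) // => j; rewrite inE.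
elim: n A => [|n IHn] A.
  by move/cards0_eq ->; rewrite subrr big_set0.
move=> An; have /card_gt0P[j jA] : (0 < #|A|)%N by rewrite An.
have An' : #|A :\ j| = n by move: An; rewrite (cardsD1 j) jA; case.
rewrite (big_setD1 j) //=.
have := Vw j (A :\ j); rewrite setD11 finset.setD1K // => /(_ isT) H1.
by have := lerD H1 (IHn _ An'); rewrite addrA subrK.
Qed.

(** * Variance bound for functions of independent indicators *)

Section EfronStein.
Variables (R : realFieldType) (J : finType) (q : J -> R).
Hypothesis q01 : forall j, 0 <= q j <= 1.

(* Exposing the coordinates one at a time, the mean square of the conditional
   expectation grows by at most [q j (1 - q j)] at coordinate [j]. *)
Lemma efron_stein (g : {set J} -> R) :
  (forall j (Y : {set J}), `|g (j |: Y) - g (Y :\ j)| <= 1) ->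
  Ex q (fun Y => (g Y - Ex q g) ^+ 2) <= \sum_j q j.
Proof.
move=> g1; pose V A := Ex q (fun Z => cond_exp q g A Z ^+ 2).
have -> : Ex q (fun Y => (g Y - Ex q g) ^+ 2) =
    V [set: J]%SET - V finset.set0.
  have -> : V [set: J]%SET = Ex q (fun Y => g Y ^+ 2).
    apply: eq_Ex => Y; rewrite /cond_exp.
    rewrite (eq_Ex (fun=> g Y)) ?Ex_const // => Z.
    by rewrite /splice finset.setIT finset.setDT finset.setU0.
  have -> : V finset.set0 = Ex q g ^+ 2.
    by rewrite /V (eq_Ex (fun=> Ex q g ^+ 2)) ?Ex_const // => Z;
       rewrite cond_exp0.
  set m := Ex q g.
  rewrite (eq_Ex (fun Y => (g Y ^+ 2 + (- (2 * m)) * g Y) + m ^+ 2)).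
    by rewrite !ExD ExZ Ex_const -/m; ring.
  by move=> Y; ring.
apply: telescope_set => j A jA; rewrite /V.
pose u Z := cond_exp q (fun Y => g (j |: Y)) A Z.
pose w Z := cond_exp q (fun Y => g (Y :\ j)) A Z.
rewrite (eq_Ex (fun Z => if j \in Z then u Z ^+ 2 else w Z ^+ 2)); last first.
  by move=> Z; rewrite cond_expU1 -/(u Z) -/(w Z); case: ifP.
rewrite Ex_ind1; try by move=> Y; rewrite /u /w cond_exp_ind.
rewrite -ExB -[leRHS](Ex_const q); apply: Ex_le => // Z.
rewrite (cond_exp_avg _ _ _ jA) -/(u Z) -/(w Z).
have uw : `|u Z - w Z| <= 1.
  rewrite /u /w /cond_exp -ExB; apply: le_trans (Ex_norm q01 _) _.
  by rewrite -[leRHS](Ex_const q); apply: Ex_le => // Y; apply: g1.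
have uw2 : (u Z - w Z) ^+ 2 <= 1.
  by rewrite -real_normK ?num_real // expr_le1.
have /andP[q0 q1] := q01 j.
have -> : q j * u Z ^+ 2 + (1 - q j) * w Z ^+ 2 - (q j * u Z + (1 - q j) * w Z) ^+ 2
   = q j * (1 - q j) * (u Z - w Z) ^+ 2 by ring.
rewrite -mulrA ler_piMr // mulr_ile1 ?sqr_ge0 ?subr_ge0 //.
by rewrite lerBlDr lerDl.
Qed.

End EfronStein.

(** * Means along a segment of probabilities *)

Section MeanValue.

Lemma deriv_prod (R : comNzRingType) (I : eqType) (s : seq I) (f : I -> {poly R}) :
  uniq s -> (\prod_(i <- s) f i)^`() =
  \sum_(j <- s) (f j)^`() * \prod_(i <- s | i != j) f i.
Proof.
elim: s => [|a s IHs] /=; first by rewrite !big_nil derivC.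
move=> /andP[ans us]; rewrite !big_cons derivM eqxx /= IHs //.
congr (_ * _ + _).
  rewrite [RHS]big_seq_cond [LHS]big_seq; apply: eq_bigl => i.
  by case: (boolP (i \in s)) => //= si; case: eqP => // ia; rewrite -ia si in ans.
rewrite big_distrr /= big_seq [RHS]big_seq; apply: eq_bigr => j js.
rewrite big_cons ifT; first by rewrite mulrCA.
by apply: contraNneq ans => ->.
Qed.

(** Along the segment the mean is a polynomial in one variable, so the mean value theorem for
    polynomials applies; [Ex_diff] identifies the partial derivatives. *)
Lemma Ex_mvt (R : rcfType) (J : finType) (q d : J -> R) (g : {set J} -> R) :
  exists2 x : R, 0 < x < 1 &
  Ex (fun j => q j + d j) g - Ex q g =
  \sum_j d j * Ex (fun j => q j + x * d j) (fun Y => g (j |: Y) - g (Y :\ j)).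
Proof.
pose QP j := (q j)%:P + d j *: 'X.
pose P := Ex QP (fun Y => (g Y)%:P).
have bernx x Y : (bern QP Y).[x] = bern (fun j => q j + x * d j) Y.
  rewrite /bern horner_prod; apply: eq_bigr => j _.
  by case: ifP => _; rewrite !hornerE [d j * x]mulrC.
have bernbx j x Y : (bern_but j QP Y).[x] = bern_but j (fun j => q j + x * d j) Y.
  rewrite /bern_but horner_prod; apply: eq_bigr => i _.
  by case: ifP => _; rewrite !hornerE [d i * x]mulrC.
have Px x : P.[x] = Ex (fun j => q j + x * d j) g.
  by rewrite /P /Ex horner_sum; apply: eq_bigr => Y _; rewrite !hornerE bernx.
have [x x01 PE] := poly_mvt P (@ltr01 R); exists x.
  by move: x01; rewrite in_itv.
rewrite subr0 mulr1 !Px in PE.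
have -> : Ex (fun j => q j + d j) g = Ex (fun j => q j + 1 * d j) g.
  by congr Ex; apply/funext => j; rewrite mul1r.
have -> : Ex q g = Ex (fun j => q j + 0 * d j) g.
  by congr Ex; apply/funext => j; rewrite mul0r addr0.
rewrite PE.
have -> : P^`() = \sum_(Y : {set J}) \sum_j
    ((d j)%:P * ((if j \in Y then 1 else -1) * bern_but j QP Y * (g Y)%:P)).
  rewrite /P /Ex raddf_sum; apply: eq_bigr => Y _.
  rewrite /= derivM derivC mulr0 addr0 /bern deriv_prod ?index_enum_uniq //.
  rewrite big_distrl /=; apply: eq_bigr => j _.
  rewrite /bern_but !mulrA; congr (_ * _ * _).
  have QP' : (QP j)^`() = (d j)%:P.
    by rewrite /QP derivD derivC derivZ derivX add0r -mul_polyC mulr1.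
  by case: ifP => _; rewrite ?mulr1 // derivB derivC QP' sub0r mulrN1.
rewrite exchange_big horner_sum; apply: eq_bigr => j _ /=.
rewrite Ex_diff horner_sum big_distrr /=; apply: eq_bigr => Y _.
rewrite !hornerM !hornerC bernbx; congr (_ * (_ * _ * _)).
by case: ifP => _; rewrite ?hornerN hornerC.
Qed.

Lemma Ex_lipschitz (R : rcfType) (J : finType) (q q' : J -> R)
    (g : {set J} -> R) :
  (forall j, 0 <= q j <= 1) -> (forall j, 0 <= q' j <= 1) ->
  (forall j (Y : {set J}), `|g (j |: Y) - g (Y :\ j)| <= 1) ->
  `|Ex q' g - Ex q g| <= \sum_j `|q' j - q j|.
Proof.
move=> q01 q'01 g1.
have [x /andP[x0 x1]] := Ex_mvt q (fun j => q' j - q j) g.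
have -> : (fun j => q j + (q' j - q j)) = q'.
  by apply/funext => j; rewrite addrC subrK.
move->; apply: le_trans (ler_norm_sum _ _ _) _; apply: ler_sum => j _.
rewrite normrM ler_piMr //.
have H i : 0 <= q i + x * (q' i - q i) <= 1.
  have /andP[? ?] := q01 i; have /andP[? ?] := q'01 i.
  by apply/andP; split; nra.
apply: le_trans (Ex_norm H _) _; rewrite -[leRHS](Ex_const (fun i => q i + x *
  (q' i - q i))).
by apply: Ex_le.
Qed.

End MeanValue.

(** * Comparison with independent indicators *)

Section PoissonComparison.
Variables (R : realFieldType) (B J : finType) (p : B -> R) (S : J -> {set B}).
Hypothesis p01 : forall b, 0 <= p b <= 1.

Definition covered (G : {set B}) : {set J} := [set j | S j \subset G].

Definition cover_prob (j : J) : R := \prod_(b in S j) p b.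

Lemma prod_prob01 (D : {set B}) : 0 <= \prod_(b in D) p b <= 1.
Proof.
apply/andP; split; first by apply: prodr_ge0 => b _; case/andP: (p01 b).
by apply: prodr_ile1 => b _; apply: p01.
Qed.

Lemma cond_exp_eq (q : J -> R) g (A Z Z' : {set J}) :
  Z :&: A = Z' :&: A -> cond_exp q g A Z = cond_exp q g A Z'.
Proof. by move=> ZZ; apply: eq_Ex => Y; rewrite /splice ZZ. Qed.

(* Replacing the indicator of [S j \subset G] by an independent one of the same
   probability has the same effect as comparing G with [S j :|: G], which
   covers a new [S j'] only if [S j' :\: S j] is already covered. *)
Lemma covered_compare (g : {set J} -> R) (L : R) :
  (forall j (Y : {set J}), `|g (j |: Y) - g (Y :\ j)| <= L) ->
  `|Ex p (fun G => g (covered G)) - Ex cover_prob g| <=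
  \sum_j cover_prob j * (2 * L *
    \sum_(j' | (j' != j) && ~~ [disjoint S j' & S j])
       \prod_(b in S j' :\: S j) p b).
Proof.
move=> gL; set q := cover_prob.
have q01 j : 0 <= q j <= 1 by apply: prod_prob01.
pose V A := Ex p (fun G => cond_exp q g A (covered G)).
have VT : V [set: J]%SET = Ex p (fun G => g (covered G)).
  apply: eq_Ex => G; rewrite /cond_exp (eq_Ex (fun=> g (covered G))) ?Ex_const // => Y.
  by rewrite /splice finset.setIT finset.setDT finset.setU0.
have V0 : V finset.set0 = Ex q g.
  by rewrite /V (eq_Ex (fun=> Ex q g)) ?Ex_const // => G; rewrite cond_exp0.
have step j (A : {set J}) : j \notin A -> `|V (j |: A) - V A| <=
    q j * (2 * L * \sum_(j' | (j' != j) && ~~ [disjoint S j' & S j])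
       \prod_(b in S j' :\: S j) p b).
  move=> jA.
  pose u Z := cond_exp q (fun Y => g (j |: Y)) A Z.
  pose w Z := cond_exp q (fun Y => g (Y :\ j)) A Z.
  pose D G := u (covered G) - w (covered G).
  have DL G : `|D G| <= L.
    rewrite /D /u /w /cond_exp -ExB; apply: le_trans (Ex_norm q01 _) _.
    by rewrite -[leRHS](Ex_const q); apply: Ex_le => // Y; apply: gL.
  (* The difference is the mean of [D G] times the centred indicator of [S j \subset G];
     conditioning on that event amounts to adding [S j] to [G]. *)
  have -> : V (j |: A) - V A = q j * Ex p (fun G => D (S j :|: G) - D G).
    rewrite ExB mulrBr -Ex_subset -ExZ -!ExB; apply: eq_Ex => G.
    rewrite cond_expU1 (cond_exp_avg q g _ jA) -/(u _) -/(w _) inE /D.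
    by case: (S j \subset G) => /=; ring.
  have /andP[q0 _] := q01 j.
  rewrite normrM (ger0_norm q0); apply: ler_wpM2l => //.
  apply: le_trans (Ex_norm p01 _) _.
  have -> : \sum_(j' | (j' != j) && ~~ [disjoint S j' & S j])
       \prod_(b in S j' :\: S j) p b =
     Ex p (fun G => \sum_(j' | (j' != j) && ~~ [disjoint S j' & S j])
       (S j' :\: S j \subset G)%:R).
    rewrite Ex_sum; apply: eq_bigr => j' _.
    rewrite (eq_Ex (fun G => (S j' :\: S j \subset G)%:R * 1)).
      by rewrite Ex_subset Ex_const mulr1.
    by move=> G; rewrite mulr1.
  rewrite -ExZ; apply: Ex_le => // G.
  have L0 : 0 <= L by apply: le_trans (DL G).
  have sum0 (P : pred J) : 0 <= \sum_(j' | P j') (S j' :\: S j \subset G)%:R :> R.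
    by apply: sumr_ge0.
  (* [D] sees [covered G] only through [A]. If adding [S j] changes this trace, some [j'] in [A] is
     newly covered, and [2 * L] is charged to its term of the sum. *)
  have [E|] := eqVneq (covered (S j :|: G) :&: A) (covered G :&: A).
    by rewrite /D /u /w !(cond_exp_eq _ _ E) subrr normr0 !mulr_ge0.
  rewrite finset.eqEsubset negb_and [X in _ || X](_ : _ = false) ?orbF; last first.
    apply/negbTE; rewrite negbK; apply: finset.setSI; apply/fintype.subsetP => i.
    by rewrite !inE => /fintype.subset_trans; apply; rewrite finset.subsetUr.
  case/fintype.subsetPn => j'; rewrite !inE => /andP[Sj' j'A]; rewrite j'A andbT => nS.
  apply: le_trans (_ : _ <= L + L) _.
    by apply: le_trans (ler_normB _ _) _; apply: lerD.
  have -> : L + L = 2 * L by ring.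
  apply: ler_peMr; first exact: mulr_ge0.
  rewrite (bigD1 j') /=; last first.
    apply/andP; split; first by apply: contraNneq jA => <-.
    apply: contra nS => dis; apply/fintype.subsetP => b bS.
    have := fintype.subsetP Sj' _ bS; rewrite inE => /orP[bj|//].
    by rewrite -setI_eq0 in dis; move/eqP/finset.setP/(_ b): dis; rewrite !inE bS bj.
  have -> : S j' :\: S j \subset G by rewrite subDset.
  by rewrite lerDl; apply: sumr_ge0.
rewrite -VT -V0 ler_norml lerNl opprB; apply/andP; split.
  rewrite -[V finset.set0]opprK addrC.
  apply: (@telescope_set _ _ (fun A => - V A)) => j A jA.
  by rewrite opprK addrC -opprB; apply: le_trans (ler_norm _) _; rewrite
    normrN; apply: step.
by apply: telescope_set => j A jA; apply: le_trans (ler_norm _) (step j A jA).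
Qed.

End PoissonComparison.

(** * Colourings of hypergraphs *)

Section MinMono.
Variables (V J : finType) (S : J -> {set V}).
Implicit Types (Y : {set J}) (A E : {set V}) (j : J).

Definition mono A E : bool := (E \subset A) || (E \subset ~: A).

Definition cost Y A : nat := #|[set j in Y | mono A (S j)]|.

Definition minmono Y : nat := cost Y [arg min_(A < finset.set0) cost Y A]%N.

Definition optimal Y A : bool := cost Y A == minmono Y.

Lemma minmono_le Y A : (minmono Y <= cost Y A)%N.
Proof. by rewrite /minmono; case: arg_minnP => // A0 _; apply. Qed.

Lemma minmono_opt Y : exists A, optimal Y A.
Proof. by exists [arg min_(A < finset.set0) cost Y A]%N; rewrite /optimal. Qed.

Lemma costU1 Y j A : j \notin Y -> cost (j |: Y) A = (cost Y A + mono A (S j))%N.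
Proof.
move=> jY; rewrite /cost (cardsD1 j) !inE eqxx /= addnC; congr (_ + _)%N.
apply: eq_card => i; rewrite !inE; case: eqP => [->|] //=.
by rewrite (negPf jY).
Qed.

(** An optimal colouring of [Y] that splits [S j] keeps its cost. If there is none, the optimal
    colourings all gain 1, and the others already cost at least one more than the minimum. *)
Lemma minmonoU1 Y j : j \notin Y -> minmono (j |: Y) =
  (minmono Y + [forall A, optimal Y A ==> mono A (S j)])%N.
Proof.
move=> jY; apply/eqP; rewrite eqn_leq; apply/andP; split.
  case: forallP => [_|/forallP].
    have [A /eqP oA] := minmono_opt Y.
    by apply: leq_trans (minmono_le _ A) _; rewrite costU1 // oA leq_add2l leq_b1.
  rewrite negb_forall => /existsP[A]; rewrite negb_imply => /andP[/eqP oA nA].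
  by apply: leq_trans (minmono_le _ A) _; rewrite costU1 // oA (negPf nA).
have [A /eqP <-] := minmono_opt (j |: Y); rewrite costU1 //.
case: forallP => [/(_ A) oA|_]; last first.
  by rewrite addn0; apply: leq_trans (minmono_le _ A) (leq_addr _ _).
have := minmono_le Y A; rewrite leq_eqVlt => /orP[/eqP oA'|lt].
  by rewrite oA' leq_add2l; case: (mono A (S j)) oA => //; rewrite /optimal oA' eqxx.
by rewrite addn1; apply: leq_trans lt (leq_addr _ _).
Qed.

Lemma minmono_incr Y j :
  (minmono (Y :\ j) <= minmono (j |: Y) <= (minmono (Y :\ j)).+1)%N.
Proof.
have jY : j \notin Y :\ j by rewrite !inE eqxx.
have := minmonoU1 jY; rewrite setU1D1 => ->.
by rewrite leq_addr /= -addn1 leq_add2l leq_b1.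
Qed.

Lemma minmono_lipschitz (R : realDomainType) Y j :
  `|(minmono (j |: Y))%:R - (minmono (Y :\ j))%:R| <= 1 :> R.
Proof.
have /andP[le1 le2] := minmono_incr Y j.
rewrite -natrB // normr_nat -[leRHS]/(1%:R) ler_nat.
by rewrite leq_subLR addn1.
Qed.

(* [u] and [v] have the same image iff they share their colour in every optimal
   colouring. *)
Definition frozen Y (v : V) : {set {set V}} := [set A | optimal Y A && (v \in A)].

End MinMono.

Definition constant_on (V W : finType) (kappa : V -> W) (E : {set V}) : bool :=
  [forall u in E, forall v in E, kappa u == kappa v].

Lemma constant_onP (V W : finType) (kappa : V -> W) (E : {set V}) :
  reflect {in E &, forall u v, kappa u = kappa v} (constant_on kappa E).
Proof.
apply: (iffP forall_inP) => [H u v uE vE|H u uE].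
  by have /forall_inP/(_ v vE)/eqP := H u uE.
by apply/forall_inP => v vE; apply/eqP/H.
Qed.

(** Being monochromatic is a condition on pairs of vertices, so it can be tested for all optimal
    colourings at once through a single equivalence relation. *)
Lemma frozen_mono (V J : finType) (S : J -> {set V}) (Y : {set J}) (E : {set V}) :
  [forall A, optimal S Y A ==> mono A E] = constant_on (frozen S Y) E.
Proof.
apply/forallP/constant_onP => [H u v uE vE|H A].
  apply/finset.setP => A; rewrite !inE; case oA: (optimal S Y A) => //=.
  have := implyP (H A) oA.
  by case/orP => /fintype.subsetP EA; have := EA u uE; have := EA v vE;
    rewrite ?inE => ? ?; apply/idP/idP => //; apply/contraLR.
apply/implyP => oA; rewrite /mono.
have [->|[u uE]] := finset.set_0Vmem E; first by rewrite finset.sub0set.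
have uv v : v \in E -> (v \in A) = (u \in A).
  by move=> vE; have /finset.setP/(_ A) := H v u vE uE; rewrite !inE oA.
case uA: (u \in A); apply/orP; [left|right]; apply/fintype.subsetP => v vE;
  by rewrite ?inE uv ?uA.
Qed.

(** * Sets inside classes, and sums of powers *)

Section Counting.

Lemma leq_exp2rn a b r : (a <= b)%N -> (a ^ r <= b ^ r)%N.
Proof. by case: r => // r ab; rewrite leq_exp2r. Qed.

Definition num_constant (V W : finType) (r : nat) (kappa : V -> W) : nat :=
  #|[set E : {set V} | (#|E| == r) && constant_on kappa E]|.

(** A nonempty constant set lies in exactly one class; for [r = 0] the empty set would be counted
    once per class on the right. *)
Lemma num_constantE (V W : finType) r (kappa : V -> W) : (0 < r)%N ->
  num_constant r kappa = (\sum_w 'C(#|[set v | kappa v == w]|, r))%N.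
Proof.
move=> r0; under eq_bigr do rewrite -cards_draws -sum1_card big_mkcond.
rewrite exchange_big /num_constant -sum1_card big_mkcond; apply: eq_bigr => E _ /=.
under eq_bigr do rewrite inE.
rewrite inE; case: eqP => [Er|_] /=; last by rewrite big1 // => w _; rewrite andbF.
have /card_gt0P[v vE] : (0 < #|E|)%N by rewrite Er.
case: constant_onP => [H|H].
  rewrite (bigD1 (kappa v)) //= andbT ifT.
    rewrite big1 // => w wv; case: ifP => //; rewrite andbT =>
      /fintype.subsetP/(_ v vE).
    by rewrite inE eq_sym (negPf wv).
  by apply/fintype.subsetP => u uE; rewrite inE; apply/eqP/H.
rewrite big1 // => w _; case: ifP => //; rewrite andbT => /fintype.subsetP EW.
by case: H => a b /EW; rewrite inE => /eqP -> /EW; rewrite inE => /eqP ->.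
Qed.

Lemma ffact_le_expn m r : (m ^_ r <= m ^ r)%N.
Proof.
rewrite ffact_prod -[X in (_ ^ X)%N]card_ord -prod_nat_const.
by apply: leq_prod => i _; apply: leq_subr.
Qed.

Lemma bin_le_expn m r : ('C(m, r) <= m ^ r)%N.
Proof.
apply: leq_trans (ffact_le_expn m r); rewrite -bin_ffact.
by rewrite leq_pmulr ?fact_gt0.
Qed.

(** Replacing the new factor [m - r.+1] by [m] costs at most [r.+1 * m ^_ r.+1]; the square as
    coefficient survives the induction because [k + k ^ 2 <= k.+1 ^ 2]. *)
Lemma expn_le_ffact m r : (m ^ r.+1 <= m ^_ r.+1 + r.+1 ^ 2 * m ^ r)%N.
Proof.
elim: r => [|r IHr]; first by rewrite expn1 ffactn1 leq_addr.
have H1 : (m ^_ r.+1 * m <= m ^_ r.+2 + r.+1 * m ^_ r.+1)%N.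
  rewrite [(m ^_ r.+2)%N]ffactnSr [(r.+1 * _)%N]mulnC -mulnDr leq_mul2l.
  by rewrite addnC -leq_subLR leqnn orbT.
have H2 : (m ^_ r.+1 <= m ^ r.+1)%N.
  rewrite ffact_prod -[X in (_ ^ X)%N]card_ord -prod_nat_const.
  by apply: leq_prod => i _; apply: leq_subr.
have H3 : (r.+1 * m ^_ r.+1 + r.+1 ^ 2 * m ^ r.+1 <= r.+2 ^ 2 * m ^ r.+1)%N.
  apply: leq_trans (_ : _ <= (r.+1 + r.+1 ^ 2) * m ^ r.+1)%N _.
    by rewrite mulnDl leq_add2r leq_mul2l H2 orbT.
  by rewrite leq_mul2r; apply/orP; right; lia.
rewrite expnSr; apply: leq_trans (leq_mul IHr (leqnn m)) _.
rewrite mulnDl -mulnA -expnSr; apply: leq_trans (leq_add H1 (leqnn _)) _.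
by rewrite -addnA leq_add2l.
Qed.

Lemma chebyshev_expn a b r : (a ^ r * b + b ^ r * a <= a ^ r.+1 + b ^ r.+1)%N.
Proof.
wlog ab : a b / (a <= b)%N.
  by case/orP: (leq_total a b) => ab H; [|rewrite addnC [leqRHS]addnC]; apply: H.
have abr : (a ^ r <= b ^ r)%N by apply: leq_exp2rn.
rewrite !expnSr; nia.
Qed.

(** Chebyshev's sum inequality, once per degree: twice each side is written as a sum over pairs
    [(i, j)], and the pairs are compared by [chebyshev_expn]. *)
Lemma power_mean (I : finType) (m : I -> nat) r :
  ((\sum_i m i) ^ r.+1 <= #|I| ^ r * \sum_i m i ^ r.+1)%N.
Proof.
elim: r => [|r IHr].
  by rewrite expn1 expn0 mul1n; under [leqRHS]eq_bigr do rewrite expn1.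
rewrite expnSr; apply: leq_trans (_ : _ <= #|I| ^ r * (\sum_i m i ^ r.+1) *
  \sum_i m i)%N _.
  by rewrite leq_mul2r IHr orbT.
rewrite expnSr -!mulnA leq_mul2l; apply/orP; right.
rewrite -(@leq_pmul2l 2) //.
have <- : (\sum_i \sum_j (m i ^ r.+1 * m j + m j ^ r.+1 * m i) =
    2 * ((\sum_i m i ^ r.+1) * \sum_i m i))%N.
  under eq_bigr do rewrite big_split /=.
  by rewrite big_split /= [X in (_ + X)%N]exchange_big /= big_distrlr mul2n -addnn.
have <- : (\sum_i \sum_j (m i ^ r.+2 + m j ^ r.+2) =
    2 * (#|I| * \sum_i m i ^ r.+2))%N.
  under eq_bigr do rewrite big_split /= sum_nat_const.
  by rewrite big_split /= -big_distrr sum_nat_const /= mul2n -addnn.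
by apply: leq_sum => i _; apply: leq_sum => j _; apply: chebyshev_expn.
Qed.

(* [r`!] times the number of [r]-sets inside classes of [kappa] is a sum of
   falling factorials of the class sizes, up to lower-order terms a sum of
   [r]-th powers; convexity of [x ^ r] then bounds it by the count inside the
   parts [{i} * U], rescaled. *)
Lemma num_constant_split (I U W : finType) (kappa : I * U -> W) r :
  (r.+2`! * num_constant r.+2 kappa <=
   #|I| ^ r.+1 * (r.+2`! * num_constant r.+2 (fun x => (x.1, kappa x))
                  + r.+2 ^ 2 * (#|I| * #|U| ^ r.+1)))%N.
Proof.
pose m i w := #|[set u : U | kappa (i, u) == w]|.
have mE w : #|[set x | kappa x == w]| = (\sum_i m i w)%N.
  rewrite /m; under [RHS]eq_bigr do rewrite -sum1_card big_mkcond.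
  rewrite pair_bigA -sum1_card big_mkcond.
  by apply: eq_bigr => -[i u] _; rewrite !inE.
have mE2 i w : #|[set x : I * U | (x.1, kappa x) == (i, w)]| = m i w.
  rewrite /m -(@card_imset U _ (fun u => (i, u))); last by move=> u v [].
  apply: eq_card => -[i' u]; rewrite inE -pair_eqE /=.
  apply/andP/imsetP => [[/eqP -> kw]|[u' + [-> ->]]]; last by rewrite inE.
  by exists u; rewrite ?inE.
have mU i w : (m i w <= #|U|)%N by apply: max_card.
have mS i : (\sum_w m i w = #|U|)%N.
  rewrite /m; under eq_bigr do rewrite -sum1_card big_mkcond.
  rewrite exchange_big /= -sum1_card; apply: eq_bigr => u _.
  under eq_bigr do rewrite inE eq_sym.
  by rewrite -big_mkcond /= big_pred1_eq.
rewrite !num_constantE // [X in (_ <= _ * (_ * X + _))%N](_ : _ =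
   \sum_w \sum_i 'C(m i w, r.+2))%N; last first.
  rewrite exchange_big /= pair_bigA /=.
  by apply: eq_bigr => -[i w] _; rewrite mE2.
under [X in (_ * X <= _)%N]eq_bigr do rewrite mE.
rewrite big_distrr /= [X in (_ <= _ * (X + _))%N]big_distrr /=.
apply: leq_trans (_ : _ <= #|I| ^ r.+1 * \sum_w \sum_i m i w ^ r.+2)%N _.
  rewrite [leqRHS]big_distrr; apply: leq_sum => w _ /=.
  apply: leq_trans (power_mean _ _); rewrite mulnC bin_ffact.
  exact: ffact_le_expn.
rewrite leq_mul2l; apply/orP; right.
(* One factor [m i w] of the error is kept and the others are bounded by [#|U|]: summed over [w] it
   gives [#|U|], whatever the number of classes. *)
apply: leq_trans (_ : _ <= \sum_w \sum_i
  (r.+2`! * 'C(m i w, r.+2) + r.+2 ^ 2 * (m i w * #|U| ^ r)))%N _.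
  apply: leq_sum => w _; apply: leq_sum => i _.
  rewrite [X in (_ <= X + _)%N]mulnC bin_ffact.
  apply: leq_trans (expn_le_ffact _ _) _; rewrite leq_add2l leq_mul2l.
  by rewrite [(m i w ^ r.+1)%N]expnS [in X in _ || X]leq_mul2l leq_exp2rn ?mU ?orbT.
under eq_bigr do rewrite big_split /=.
rewrite big_split /=; apply: leq_add.
  by apply: leq_sum => w _; rewrite -big_distrr.
rewrite exchange_big /=; under eq_bigr do rewrite -big_distrr -big_distrl /= mS.
by rewrite sum_nat_const mulnCA -expnS.
Qed.

End Counting.

(** * Interpolation *)

(** An optimal colouring for [Y] is pulled back along [f]: an edge and its image are monochromatic
    together, and edges of [Y] outside the range of [F] can only add to the cost upstairs. *)
Lemma minmono_preim (V V' J J' : finType) (S : J -> {set V}) (S' : J' -> {set V'})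
    (f : V -> V') (F : J -> J') (Y : {set J'}) :
  injective F -> (forall j, S' (F j) = f @: S j) ->
  (minmono S (F @^-1: Y) <= minmono S' Y)%N.
Proof.
move=> Finj SF; have [A /eqP <-] := minmono_opt S' Y.
apply: leq_trans (minmono_le _ _ (f @^-1: A)) _.
rewrite /cost -(card_imset _ Finj); apply: subset_leq_card.
apply/fintype.subsetP => _ /imsetP[j + ->]; rewrite !inE => /andP[-> /=].
by rewrite /mono SF !sub_imset_pre preimsetC.
Qed.

Section Interpolation.
Variables (R : rcfType) (b r' : nat).
Local Notation r := r'.+2.

(* The multiplicity label in ['I_b] accounts for the several copies of a graph
   on one vertex set. *)
Definition lab (V : finType) : finType := ({set V} * 'I_b)%type.

(** Sets of the wrong size stay in the index type, with probability 0; [eq_ExP] discards them. *)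
Definition lab_prob (V : finType) (x : R) (j : lab V) : R :=
  if #|j.1| == r then x else 0.

Definition hmin (V : finType) (Y : {set lab V}) : R :=
  (minmono (fun j : lab V => j.1) Y)%:R.

Definition mean_min (V : finType) (x : R) : R := Ex (@lab_prob V x) (@hmin V).

Lemma sum_lab (V : finType) (F : {set V} -> R) :
  \sum_(j : lab V) F j.1 = b%:R * \sum_E F E.
Proof.
rewrite -(pair_bigA _ (fun E (k : 'I_b) => F E)) /= big_distrr.
by apply: eq_bigr => E _; rewrite /= sumr_const card_ord mulr_natl.
Qed.

Lemma sum_lab_prob (V : finType) (x : R) :
  \sum_(j : lab V) lab_prob x j = b%:R * ('C(#|V|, r))%:R * x.
Proof.
rewrite (sum_lab (fun E => if #|E| == r then x else 0)) -big_mkcond -mulrA.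
rewrite -card_draws sumr_const; congr (_ * _); rewrite mulr_natl; congr (_ *+ _).
by apply: eq_card => E; rewrite inE.
Qed.

Lemma lab_prob01 (V : finType) (x : R) (j : lab V) : 0 <= x <= 1 -> 0 <=
  lab_prob x j <= 1.
Proof. by rewrite /lab_prob; case: ifP => // _ _; rewrite lexx ler01. Qed.

Lemma hmin_lipschitz (V : finType) j (Y : {set lab V}) :
  `|hmin (j |: Y) - hmin (Y :\ j)| <= 1.
Proof. exact: minmono_lipschitz. Qed.

Definition maplab (V V' : finType) (f : V -> V') (j : lab V) : lab V' :=
  (f @: j.1, j.2).

Lemma maplab_inj (V V' : finType) (f : V -> V') :
  injective f -> injective (maplab f).
Proof. by move=> finj [E k] [E' k'] [/(imset_inj finj) -> ->]. Qed.

Lemma mean_min_inj (V V' : finType) (f : V -> V') (x : R) :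
  injective f -> 0 <= x <= 1 -> mean_min V x <= mean_min V' x.
Proof.
move=> finj x01; rewrite /mean_min.
have -> : Ex (@lab_prob V x) (@hmin V) = Ex (@lab_prob V' x \o maplab f) (@hmin V).
  congr Ex; apply/funext => j; by rewrite /lab_prob /= card_imset.
rewrite -(Ex_preim _ _ (maplab_inj finj)); apply: Ex_le => [j|Y].
  exact: lab_prob01.
by rewrite ler_nat; apply: (minmono_preim (f := f)) => //; apply: maplab_inj.
Qed.

Lemma mean_min_lipschitz (V : finType) (x y : R) :
  0 <= x <= 1 -> 0 <= y <= 1 ->
  `|mean_min V x - mean_min V y| <= b%:R * ('C(#|V|, r))%:R * `|x - y|.
Proof.
move=> x01 y01; rewrite -sum_lab_prob.
apply: le_trans (Ex_lipschitz _ _ _) _ => [j|j|j Y|]; try exact: lab_prob01.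
  exact: hmin_lipschitz.
apply: ler_sum => j _; rewrite /lab_prob; case: ifP => //.
by rewrite subrr normr0.
Qed.

Variables (I U : finType).

Definition inner (E : {set I * U}) : bool := constant_on fst E.

Definition inner_prob (y : R) (j : lab (I * U)%type) : R := if inner j.1 then
  lab_prob y j else 0.

(** Optimal colourings of the parts, chosen separately, glue to a colouring of [I * U]; a
    monochromatic inner edge is charged to the part containing it. *)
Lemma hmin_inner (Y : {set lab (I * U)%type}) :
  (forall j, j \in Y -> inner j.1 && (j.1 != finset.set0)) ->
  hmin Y <= \sum_i hmin (maplab (fun u : U => (i, u)) @^-1: Y).
Proof.
move=> Yin.
pose F (i : I) := maplab (fun u : U => (i, u)).
have Finj i : injective (F i) by apply: maplab_inj => u v [].
have [A oA] : {A : I -> {set U} &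
    forall i, optimal (fun j : lab U => j.1) (F i @^-1: Y) (A i)}.
  by apply: (@choice _ _ (fun i B => optimal (fun j : lab U => j.1) (F i @^-1: Y) B))
    => i; apply: minmono_opt.
pose B := [set x : I * U | x.2 \in A x.1].
rewrite /hmin -natr_sum ler_nat; apply: leq_trans (minmono_le _ _ B) _.
under eq_bigr => i _ do rewrite -(eqP (oA i)).
rewrite /cost -sum1_card.
under [leqRHS]eq_bigr => i _ do rewrite -(card_imset _ (Finj i)) -sum1_card big_mkcond.
rewrite exchange_big big_mkcond; apply: leq_sum => j _ /=.
case: ifPn => //; rewrite inE => /andP[jY Bj].
have /andP[/constant_onP jin /finset.set0Pn[[i u0] iu0]] := Yin j jY.
rewrite (bigD1 i) //= ifT; first by rewrite leq_addr.
have jE : j.1 = (fun u : U => (i, u)) @: [set u | (i, u) \in j.1].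
  apply/finset.setP => -[i' u]; apply/idP/imsetP => [iu|[u' + [-> ->]]].
    have /= ii := jin _ _ iu0 iu; move: iu; rewrite -ii => iu.
    by exists u; rewrite ?inE.
  by rewrite inE.
apply/imsetP; exists ([set u | (i, u) \in j.1], j.2); last first.
  by rewrite /F /maplab -jE -surjective_pairing.
rewrite !inE /F /maplab -jE -surjective_pairing jY /=.
have BA : (fun u : U => (i, u)) @^-1: B = A i.
  by apply/finset.setP => u; rewrite !inE.
by move: Bj jE; set E := [set u | _] => + jE; rewrite jE /mono !sub_imset_pre
  preimsetC BA.
Qed.

Lemma inner_prob01 (y : R) j : 0 <= y <= 1 -> 0 <= inner_prob y j <= 1.
Proof.
by move=> y01; rewrite /inner_prob; case: ifP => _; [exact: lab_prob01|rewrite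
  lexx ler01].
Qed.

Lemma Ex_inner (y : R) : 0 <= y <= 1 ->
  Ex (inner_prob y) (@hmin (I * U)%type) <= #|I|%:R * mean_min U y.
Proof.
move=> y01.
have -> : #|I|%:R * mean_min U y =
    \sum_(i : I) Ex (inner_prob y) (fun Y => hmin (maplab (fun u : U => (i, u))
      @^-1: Y)).
  rewrite mulr_natl -sumr_const; apply: eq_bigr => i _.
  rewrite Ex_preim; last by apply: maplab_inj => u v [].
  congr Ex; apply/funext => j; rewrite /inner_prob /lab_prob /= card_imset;
    last by move=> u v [].
  suff -> : inner [set (i, u) | u in j.1] by [].
  apply/constant_onP => _ _ /imsetP[u _ ->] /imsetP[v _ ->].
  by [].
(* The bound of [hmin_inner] fails for general [Y], but only on a null event. Taking [Num.min] with
   the bound makes it hold everywhere and leaves the mean unchanged. *)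
rewrite -Ex_sum; rewrite (@eq_ExP _ _ _ (@hmin _)
  (fun Y => Num.min (hmin Y) (\sum_i hmin (maplab (fun u : U => (i, u)) @^-1: Y)))).
  apply: Ex_le => [j|Y]; first exact: inner_prob01.
  by rewrite ge_min lexx orbT.
move=> Y Yq; rewrite min_l // hmin_inner // => j /Yq.
rewrite /inner_prob /lab_prob; case: ifP => //=; last by rewrite eqxx.
case: ifP => [/eqP jr _ _|]; last by rewrite eqxx.
by rewrite -card_gt0 jr.
Qed.

(** With k = [#|I|] and n = [#|U|], the scaling makes C(kn, r) y / k^(r-1) and k C(n, r) y agree to
    leading order, so both hypergraphs have about equally many edges. The first error term comes
    from [num_constant_split], the second from edges already present when they are added. *)
Lemma interpolation (y : R) : 0 <= y <= 1 -> (0 < #|I|)%N ->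
  mean_min (I * U)%type (y / #|I|%:R ^+ r'.+1) <=
  #|I|%:R * (mean_min U y + b%:R * ((r ^ 2)%:R * (#|U|%:R ^+ r'.+1 * y)
                                + 2 * (#|U|%:R ^+ r * y ^+ 2))).
Proof.
move=> y01 I0; have /andP[y0 y1] := y01.
set k : R := #|I|%:R; set n0 : R := #|U|%:R.
have k1 : 1 <= k by rewrite -[leLHS]/(1%:R) ler_nat.
have k0 : 0 < k by apply: lt_le_trans k1.
have kr1 : 1 <= k ^+ r'.+1 by rewrite exprn_ege1.
have kr0 : 0 < k ^+ r'.+1 by rewrite exprn_gt0.
set x := y / k ^+ r'.+1.
have x0 : 0 <= x by rewrite divr_ge0 // ltW.
have xy : x <= y by rewrite ler_pdivrMr // ler_peMr.
have x01 : 0 <= x <= 1 by rewrite x0 (le_trans xy).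
pose g := @hmin (I * U)%type.
pose q0 := @lab_prob (I * U)%type x; pose q1 := inner_prob y.
have q001 j : 0 <= q0 j <= 1 by exact: lab_prob01.
have q101 j : 0 <= q1 j <= 1 by exact: inner_prob01.
have [xi /andP[xi0 xi1]] := Ex_mvt q0 (fun j => q1 j - q0 j) g.
have -> : (fun j => q0 j + (q1 j - q0 j)) = q1.
  by apply/funext => j; rewrite addrC subrK.
set q := (fun j => q0 j + xi * (q1 j - q0 j)) => EQ.
have q01 j : 0 <= q j <= 1.
  have /andP[? ?] := q001 j; have /andP[? ?] := q101 j.
  by rewrite /q; apply/andP; split; nra.
suff H : \sum_j (q0 j - q1 j) * Ex q (fun Y => g (j |: Y) - g (Y :\ j)) <=
   k * (b%:R * ((r ^ 2)%:R * (n0 ^+ r'.+1 * y) + 2 * (n0 ^+ r * y ^+ 2))).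
  rewrite mulrDr; apply: le_trans (lerD (Ex_inner y01) H).
  rewrite -/q1 -/g -lerBlDl /mean_min -/q0 -/g -opprB EQ -sumrN.
  by rewrite le_eqVlt; apply/orP; left; apply/eqP/eq_bigr => j _; rewrite -mulNr opprB.
(* For [j] outside [Y] the increment is the indicator [z j.1]. For [j] in [Y] both lie in [0, 1],
   and their discrepancy goes into the last sum. *)
have pt (Y : {set lab (I * U)%type}) :
  \sum_j (q0 j - q1 j) * (g (j |: Y) - g (Y :\ j)) <=
  k * (b%:R * ((r ^ 2)%:R * (n0 ^+ r'.+1 * y))) +
  \sum_j `|q0 j - q1 j| * (j \in Y)%:R.
  pose kap := frozen (fun j : lab (I * U)%type => j.1) Y.
  pose z E : R := (constant_on kap E)%:R.
  apply: le_trans (_ : _ <= \sum_(j : lab (I * U)%type) ((q0 j - q1 j) * z j.1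
    + `|q0 j - q1 j| * (j \in Y)%:R)) _.
    apply: ler_sum => j _; case: (boolP (j \in Y)) => jY /=; last first.
      rewrite mulr0 addr0 setD1_id // /g /hmin minmonoU1 // natrD [_%:R + _]addrC addrK.
      by rewrite frozen_mono.
    rewrite mulr1 -lerBlDl -mulrBr; apply: le_trans (ler_norm _) _.
    rewrite normrM ler_piMr //.
    have /andP[m1 m2] := minmono_incr (fun j : lab (I * U)%type => j.1) Y j.
    rewrite -(ler_nat R) in m1; rewrite -(ler_nat R) -addn1 natrD in m2.
    have z0 : 0 <= z j.1 <= 1 by rewrite /z; case: constant_on; rewrite ?lexx ler01.
    by move: z0 => /andP[z0 z1]; rewrite ler_norml /g /hmin; apply/andP; split; lra.
  rewrite big_split /= lerD2r.
  rewrite (eq_bigr (fun j : lab (I * U)%type => (if (#|j.1| == r) then (x -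
    (inner j.1)%:R * y) * z j.1 else 0)));
    last first.
    move=> j _; rewrite /q0 /q1 /inner_prob /lab_prob; case: ifP => _; case:
      ifP => _ //=;
    by rewrite ?mul1r // ?mul0r // subrr mul0r.
  rewrite (sum_lab (fun E => if #|E| == r then (x - (inner E)%:R * y) * z E else 0)).
  rewrite mulrCA ler_wpM2l // -big_mkcond /=.
  have -> : \sum_(E : {set I * U} | #|E| == r) (x - (inner E)%:R * y) * z E =
    x * (num_constant r kap)%:R - y * (num_constant r (fun u => (u.1, kap u)))%:R.
    rewrite /num_constant -!sum1_card !natr_sum !big_distrr /= !(big_mkcond
      (fun E => E \in _)) /=.
    rewrite -sumrB big_mkcond; apply: eq_bigr => E _; rewrite !inE /z.
    have -> : constant_on (fun u => (u.1, kap u)) E = inner E && constant_on kap E.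
      apply/constant_onP/andP => [H|[/constant_onP H1 /constant_onP H2] u v uE vE].
        by split; apply/constant_onP => u v uE vE; case: (H u v uE vE).
      by congr pair; [exact: H1|exact: H2].
    case: (#|E| == r) => /=; last by rewrite subrr.
    by case: (inner E); case: (constant_on kap E); rewrite /=; ring.
  set m1 := num_constant _ _; set m2 := num_constant _ _.
  have := num_constant_split kap r'; rewrite -/m1 -/m2.
  have := fact_gt0 r; move: (r`!)%N => fa fa0 split_n.
  pose f : R := fa%:R.
  have split_le : f * m1%:R <= k ^+ r'.+1 * (f * m2%:R + r%:R ^+ 2 * (k * n0 ^+ r'.+1)).
    by move: split_n; rewrite -(ler_nat R) !(natrM, natrD, natrX).
  have f1 : 1 <= f by rewrite /f -[leLHS]/(1%:R) ler_nat.
  have f0 : 0 < f by apply: lt_le_trans f1.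
  rewrite -(ler_pM2l f0).
  have h1 : x * (f * m1%:R) <= y * (f * m2%:R + r%:R ^+ 2 * (k * n0 ^+ r'.+1)).
    rewrite /x -mulrA ler_wpM2l // mulrC ler_pdivrMr // [leRHS]mulrC.
    exact: split_le.
  set T := k * ((r ^ 2)%:R * (n0 ^+ r'.+1 * y)).
  have T0 : 0 <= T.
    by rewrite /T mulr_ge0 ?(ltW k0) // mulr_ge0 // mulr_ge0 // exprn_ge0.
  apply: le_trans (_ : T <= _); last by rewrite ler_peMl.
  have -> : T = y * (r%:R ^+ 2 * (k * n0 ^+ r'.+1)) by rewrite /T natrX; ring.
  have -> : f * (x * m1%:R - y * m2%:R) = x * (f * m1%:R) - y * (f * m2%:R) by ring.
  by rewrite lerBlDl -mulrDr.
have -> : \sum_j (q0 j - q1 j) * Ex q (fun Y => g (j |: Y) - g (Y :\ j)) =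
   Ex q (fun Y => \sum_j (q0 j - q1 j) * (g (j |: Y) - g (Y :\ j))).
  by rewrite Ex_sum; apply: eq_bigr => j _; rewrite ExZ.
apply: le_trans (Ex_le q01 pt) _.
rewrite ExD Ex_const Ex_sum !mulrDr lerD2l.
have mem_q j : Ex q (fun Y => (j \in Y)%:R) = q j.
  rewrite (eq_Ex (fun Y => ([set j]%SET \subset Y)%:R * 1)).
    by rewrite Ex_subset Ex_const mulr1 big_set1.
  by move=> Y; rewrite finset.sub1set mulr1.
(* Both [|q0 j - q1 j|] and [q j], a point of the segment, are at most the larger of [q0 j] and
   [q1 j]. *)
apply: le_trans (_ : _ <= \sum_j (q0 j ^+ 2 + q1 j ^+ 2)) _.
  apply: ler_sum => j _; rewrite ExZ mem_q.
  have /andP[? _] := q001 j; have /andP[? _] := q101 j.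
  have [le10|lt01] := lerP (q1 j) (q0 j).
    apply: le_trans (_ : q0 j ^+ 2 <= _); last by rewrite lerDl sqr_ge0.
    by rewrite expr2 /q; apply: ler_pM; nra.
  apply: le_trans (_ : q1 j ^+ 2 <= _); last by rewrite lerDr sqr_ge0.
  by rewrite expr2 /q; apply: ler_pM; nra.
have sum_q0 : \sum_j q0 j ^+ 2 <= b%:R * (k * (n0 ^+ r * y ^+ 2)).
  rewrite (eq_bigr (fun j => lab_prob (x ^+ 2) j)); last first.
    by move=> j _; rewrite /q0 /lab_prob; case: ifP => // _; rewrite expr0n.
  rewrite sum_lab_prob -mulrA ler_wpM2l //.
  apply: le_trans (_ : (k * n0) ^+ r * x ^+ 2 <= _).
    by rewrite ler_wpM2r ?sqr_ge0 // /k /n0 -natrM -natrX ler_nat card_prod bin_le_expn.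
  rewrite /x exprMn [(y / _) ^+ 2]exprMn exprVn.
  have -> : k ^+ r * n0 ^+ r * (y ^+ 2 / (k ^+ r'.+1) ^+ 2) =
    (k ^+ r / (k ^+ r'.+1) ^+ 2) * (n0 ^+ r * y ^+ 2) by ring.
  rewrite ler_wpM2r //.
    by rewrite mulr_ge0 ?sqr_ge0 // exprn_ge0.
  rewrite ler_pdivrMr ?exprn_gt0 // exprS ler_pM2l // expr2 ler_peMr //.
  exact: ltW.
have sum_q1 : \sum_j q1 j ^+ 2 <= b%:R * (k * (n0 ^+ r * y ^+ 2)).
  rewrite (eq_bigr (fun j : lab (I * U)%type => if (#|j.1| == r) && inner j.1
    then y ^+ 2 else 0)); last first.
    move=> j _; rewrite /q1 /inner_prob /lab_prob; case: (inner j.1); case: (_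
      == r) => //;
    by rewrite expr0n.
  rewrite (sum_lab (fun E => if (#|E| == r) && inner E then y ^+ 2 else 0)).
  rewrite -big_mkcond sumr_const ler_wpM2l //.
  rewrite -[leLHS]mulr_natl [k * _]mulrA ler_wpM2r ?sqr_ge0 //.
  rewrite /k /n0 -natrX -natrM ler_nat.
  set c := #|_|; have -> : c = num_constant r (fun x : I * U => x.1).
    by rewrite /c /num_constant; apply: eq_card => E; rewrite !inE.
  rewrite num_constantE // -sum_nat_const; apply: leq_sum => i _.
  apply: leq_trans (bin_le_expn _ _) _; apply: leq_exp2rn.
  rewrite -(card_imset _ (f := fun u : U => (i, u))); last by move=> u v [].
  apply: subset_leq_card; apply/fintype.subsetP => -[i' u]; rewrite inE /= => /eqP ->.
  by rewrite imset_f.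
rewrite big_split /=; apply: le_trans (lerD sum_q0 sum_q1) _.
by rewrite le_eqVlt; apply/orP; left; apply/eqP; ring.
Qed.

End Interpolation.

(** * Convergence of the mean *)

Lemma archimedean_nat (R : realType) (x : R) : exists N : nat, x <= N%:R.
Proof.
exists (Num.truncn `|x|).+1; apply: le_trans (ler_norm x) _.
exact/ltW/truncnS_gt.
Qed.

(** Fekete's argument, with blocks of equal size only: a general [n] is rounded up to a multiple of
    a near-optimal [n0], and the one-sided slope bound [E] pays for the rounding. *)
Lemma limit_of_subadditive (R : realType) (a : nat -> R) (D E : R) (n1 : nat) :
  (forall n, 0 <= a n) -> 0 <= D -> 0 <= E -> (0 < n1)%N ->
  (forall k n, (0 < k)%N -> (n1 <= n)%N -> a (k * n)%N <= k%:R * (a n + D)) ->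
  (forall n N, (n1 <= n <= N)%N -> a n <= a N + E * (N%:R - n%:R)) ->
  exists m : R, forall eps, 0 < eps -> exists N0 : nat, forall n, (N0 <= n)%N ->
    `|a n / n%:R - m| <= eps.
Proof.
move=> a0 D0 E0 n1_gt0 amul amono.
pose S : set R := [set x | exists2 n, (n1 <= n)%N & x = (a n + D) / n%:R]%classic.
have S0 x : S x -> 0 <= x.
  by move=> [n _ ->]; rewrite divr_ge0 // addr_ge0.
have Slb : has_lbound S by exists 0 => x; apply: S0.
have Sinf : has_inf S.
  by split=> //; exists ((a n1 + D) / n1%:R); exists n1.
exists (inf S) => eps eps0.
have [_ [n0 n10 ->]] := inf_adherent (divr_gt0 eps0 (ltr0Sn R 1)) Sinf.
set m := inf S; set x0 := (a n0 + D) / n0%:R => x0m.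
have n0_gt0 : (0 < n0)%N by apply: leq_trans n10.
(* Cost of rounding [n] up to a multiple of [n0]: one extra block, and at most [n0] extra vertices
   at slope [E]. *)
pose B := a n0 + D + E * n0%:R.
have B0 : 0 <= B by rewrite /B !addr_ge0 // mulr_ge0.
have [N1 BN1] := archimedean_nat (2 * B / eps).
have [N2 BN2] := archimedean_nat (D / eps).
exists (maxn n1 (maxn N1 N2)) => n; rewrite !geq_max => /and3P[n1n N1n N2n].
have n_gt0 : (0 < n)%N by apply: leq_trans n1n.
have nR : 0 < n%:R :> R by rewrite ltr0n.
have n0R : 0 < n0%:R :> R by rewrite ltr0n.
have an_low : m <= (a n + D) / n%:R by apply: ge_inf => //; exists n.
pose k := (n %/ n0).+1.
have kn : (n <= k * n0)%N by rewrite ltnW // /k -ltn_divLR.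
have kn0 : (k * n0 <= n + n0)%N.
  by rewrite /k mulSn addnC leq_add2r leq_trunc_div.
have an_up : a n <= n%:R * x0 + B.
  have /amono H : (n1 <= n <= k * n0)%N by rewrite n1n.
  have aH : 0 <= a n0 + D by rewrite addr_ge0.
  apply: le_trans H _; apply: le_trans (lerD (amul k n0 (ltn0Sn _) n10) (lexx _)) _.
  have kR : k%:R * n0%:R <= n%:R + n0%:R :> R by rewrite -natrM -natrD ler_nat.
  have -> : n%:R * x0 + B = (n%:R / n0%:R + 1) * (a n0 + D) + E * n0%:R.
    by rewrite /x0 /B; field; rewrite gt_eqF.
  apply: lerD.
    rewrite ler_wpM2r // -(ler_pM2r n0R) mulrDl mul1r divfK ?gt_eqF //.
  by rewrite ler_wpM2l // natrM lerBlDl.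
rewrite ler_norml; apply/andP; split.
  rewrite lerBrDl.
  have DN : D <= eps * n%:R.
    rewrite mulrC -ler_pdivrMr //; apply: le_trans BN2 _; by rewrite ler_nat.
  rewrite ler_pdivlMr //; rewrite ler_pdivlMr // in an_low.
  by move: an_low DN; set y := n%:R; lra.
rewrite lerBlDr ler_pdivrMr //; apply: le_trans an_up _.
have BN : B <= eps / 2 * n%:R.
  have : 2 * B <= n%:R * eps.
    by rewrite -ler_pdivrMr //; apply: le_trans BN1 _; rewrite ler_nat.
  lra.
have : n%:R * x0 <= n%:R * (m + eps / 2) by rewrite ler_wpM2l // ltW.
lra.
Qed.

Lemma one_minus_expn (R : realFieldType) (t : R) k :
  0 <= t <= 1 -> 1 - t ^+ k <= k%:R * (1 - t).
Proof.
move=> /andP[t0 t1]; elim: k => [|k IHk]; first by rewrite expr0 subrr mul0r.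
have tk : t ^+ k <= 1 by rewrite exprn_ile1.
have tk0 : 0 <= t ^+ k by rewrite exprn_ge0.
rewrite exprS -natr1; nra.
Qed.

Lemma mean_min_ge0 (R : rcfType) b r' (V : finType) (x : R) :
  0 <= x <= 1 -> 0 <= mean_min b r' V x.
Proof.
move=> x01; apply: sumr_ge0 => Y _; rewrite mulr_ge0 ?ler0n //.
by apply: bern_ge0 => j; apply: lab_prob01.
Qed.

Lemma mean_min_card_le (R : rcfType) b r' (V V' : finType) (x : R) :
  (#|V| <= #|V'|)%N -> 0 <= x <= 1 -> mean_min b r' V x <= mean_min b r' V' x.
Proof.
move=> VV; pose f (v : V) : V' := enum_val (widen_ord VV (enum_rank v)).
apply: (@mean_min_inj _ _ _ V V' f) => u v /enum_val_inj/(congr1 val) /= /val_inj.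
exact: enum_rank_inj.
Qed.

Lemma mean_min_limit (R : realType) (b r' : nat) (C : R) : 0 < C ->
  exists m : R, forall eps, 0 < eps -> exists N0 : nat, forall n, (N0 <= n)%N ->
    `|mean_min b r' 'I_n (C / n%:R ^+ r'.+1) / n%:R - m| <= eps.
Proof.
move=> C0; have [n1' Cn1] := archimedean_nat C.
pose n1 := n1'.+1.
pose x n : R := C / n%:R ^+ r'.+1.
have nX n : (0 < n)%N -> 0 < n%:R ^+ r'.+1 :> R by move=> n0; rewrite exprn_gt0 ?ltr0n.
have x01 n : (n1 <= n)%N -> 0 <= x n <= 1.
  move=> n1n; have n0 : (0 < n)%N by apply: leq_trans n1n.
  rewrite /x divr_ge0 ?(ltW C0) ?(ltW (nX _ n0)) //= ler_pdivrMr ?nX // mul1r.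
  apply: le_trans Cn1 _; rewrite -natrX ler_nat.
  apply: leq_trans (_ : n <= _)%N; first by apply: leq_trans n1n.
  by rewrite -{1}[n]expn1 leq_pexp2l.
(* Below [n1] the number [x n] may exceed 1, and the mean could be negative. *)
pose a n := if (n1 <= n)%N then mean_min b r' 'I_n (x n) else 0.
have [n|||||n N|m Hm] := @limit_of_subadditive R a
   (b%:R * ((r'.+2 ^ 2)%:R * C + 2 * C ^+ 2)) (b%:R * C * r'.+1%:R) n1.
- by rewrite /a; case: ifP => // /x01; apply: mean_min_ge0.
- have := ltW C0 => C0'.
  by rewrite mulr_ge0 // addr_ge0 // mulr_ge0 // sqr_ge0.
- by rewrite !mulr_ge0 // ltW.
- by [].
- move=> k n k0 n1n; rewrite /a n1n ifT; last first.
    by apply: leq_trans n1n _; rewrite leq_pmull.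
  have n0 : (0 < n)%N by apply: leq_trans n1n.
  have -> : x (k * n)%N = x n / #|'I_k|%:R ^+ r'.+1.
    by rewrite /x card_ord natrM exprMn [k%:R ^+ _ * _]mulrC invfM mulrA.
  have k0R : 1 <= k%:R ^+ r'.+1 :> R by rewrite exprn_ege1 // -[leLHS]/(1%:R) ler_nat.
  have /andP[xn0 xn1] := x01 n n1n.
  apply: le_trans (_ : mean_min b r' ('I_k * 'I_n)%type (x n / #|'I_k|%:R ^+
    r'.+1) <= _).
    apply: mean_min_card_le; first by rewrite card_prod !card_ord.
    rewrite card_ord divr_ge0 ?exprn_ge0 //= ler_pdivrMr ?mul1r.
      exact: le_trans xn1 k0R.
    exact: lt_le_trans k0R.
  apply: le_trans (interpolation _ _ _ (x01 n n1n) _) _; first by rewrite card_ord.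
  rewrite !card_ord ler_wpM2l // lerD2l ler_wpM2l //.
  have -> : n%:R ^+ r'.+1 * x n = C.
    by rewrite /x mulrC divfK // gt_eqF ?nX.
  rewrite lerD2l ler_wpM2l //.
  have -> : n%:R ^+ r'.+2 * x n ^+ 2 = C ^+ 2 * (n%:R * (n%:R ^+ r'.+1)^-1).
    by rewrite /x exprMn exprS exprVn; field; rewrite expf_neq0 // pnatr_eq0 -lt0n.
  rewrite ler_piMr ?sqr_ge0 // ler_pdivrMr ?nX // mul1r -natrX ler_nat.
  by rewrite -{1}[n]expn1 leq_pexp2l.
- move=> /andP[n1n nN]; rewrite /a n1n (leq_trans n1n nN).
  have n0 : (0 < n)%N by apply: leq_trans n1n.
  have N0 : (0 < N)%N by apply: leq_trans nN.
  have n0R : 0 < n%:R :> R by rewrite ltr0n.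
  have N0R : 0 < N%:R :> R by rewrite ltr0n.
  have xN01 := x01 N (leq_trans n1n nN); have xn01 := x01 n n1n.
  have nNR : n%:R <= N%:R :> R by rewrite ler_nat.
  have xNn : x N <= x n.
    by rewrite /x ler_wpM2l ?(ltW C0) // lef_pV2 ?posrE ?nX // lerXn2r ?nnegrE.
  (* More vertices at the fixed probability [x N] cannot lower the mean. What remains is the drop
     from [x n] to [x N] on [n] vertices, which is linear in [N - n]. *)
  rewrite -lerBlDl; apply: le_trans (_ : mean_min b r' 'I_n (x n) - mean_min b
    r' 'I_n (x N) <= _).
    by rewrite lerD2l lerN2; apply: mean_min_card_le; rewrite ?card_ord.
  apply: le_trans (ler_norm _) _; apply: le_trans (mean_min_lipschitz _ _ _
    xn01 xN01) _.
  rewrite card_ord ger0_norm ?subr_ge0 // -!mulrA ler_wpM2l //.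
  apply: le_trans (_ : n%:R ^+ r'.+2 * (x n - x N) <= _).
    by rewrite ler_wpM2r ?subr_ge0 // -natrX ler_nat bin_le_expn.
  have -> : n%:R ^+ r'.+2 * (x n - x N) = C * (n%:R * (1 - (n%:R / N%:R) ^+ r'.+1)).
    rewrite /x exprMn exprS exprVn; field.
    by rewrite !expf_neq0 // gt_eqF.
  rewrite ler_wpM2l ?(ltW C0) //.
  have t01 : 0 <= (n%:R / N%:R : R) <= 1.
    by rewrite divr_ge0 //= ler_pdivrMr // mul1r.
  apply: le_trans (ler_wpM2l (ltW n0R) (@one_minus_expn _ _ r'.+1 t01)) _.
  have -> : n%:R * (r'.+1%:R * (1 - n%:R / N%:R)) = r'.+1%:R * (n%:R / N%:R *
    (N%:R - n%:R)) :> R.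
    by field; rewrite gt_eqF.
  rewrite ler_wpM2l // ler_piMl ?subr_ge0 //; by case/andP: t01.
exists m => eps /Hm[N0 HN0]; exists (maxn n1 N0) => n.
rewrite geq_max => /andP[n1n N0n].
by have := HN0 n N0n; rewrite /a n1n.
Qed.

(** * Copies of F *)

Lemma edge_sub (T : finType) (G : graph T) (e : {set T}) :
  e \in edges G -> (e \subset vertices G) && (#|e| == 2%N).
Proof. by case: G => g gP; move/forall_inP: (gP); apply. Qed.

Lemma graph_eq (T : finType) (G H : graph T) :
  vertices G = vertices H -> edges G = edges H -> G = H.
Proof.
case: G H => [[V E] gP] [[V' E'] gP'] /= VV EE; apply: val_inj => /=.
by rewrite /vertices /edges /= in VV EE; rewrite VV EE.
Qed.

Lemma imset_inj_on (T U : finType) (f : T -> U) (S e e' : {set T}) :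
  {in S &, injective f} -> e \subset S -> e' \subset S ->
  f @: e = f @: e' -> e = e'.
Proof.
have half (a a' : {set T}) : {in S &, injective f} -> a \subset S -> a' \subset S ->
    f @: a = f @: a' -> a \subset a'.
  move=> finj aS a'S faa; apply/fintype.subsetP => x xa.
  have : f x \in f @: a' by rewrite -faa imset_f.
  case/imsetP => y ya' /finj ->//; [exact: (fintype.subsetP aS)|].
  exact: (fintype.subsetP a'S).
move=> finj eS e'S fee; apply/eqP; rewrite finset.eqEsubset.
by rewrite (half e e') // (half e' e).
Qed.

Lemma isomorphicP (T U : finType) (G : graph T) (H : graph U) :
  reflect (exists f : T -> U, [/\ {in vertices G &, injective f},
      f @: vertices G = vertices H
    & [set f @: (e : {set T}) | e in edges G] = edges H])
  (isomorphic G H).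
Proof.
apply: (iffP existsP) => [[f /and3P[/dinjectiveP finj /eqP fV /eqP fE]]|[f
  [finj fV fE]]].
  by exists f; split.
exists (finfun f); apply/and3P; split.
- by apply/dinjectiveP => u v uV vV; rewrite !ffunE; apply: finj.
- by rewrite -fV; apply/eqP/eq_imset => u; rewrite ffunE.
- rewrite -fE; apply/eqP/eq_imset => e; apply: eq_imset => u.
  by rewrite ffunE.
Qed.

Lemma isomorphic_card (T U : finType) (G : graph T) (H : graph U) :
  isomorphic G H -> #|vertices H| = #|vertices G| /\ #|edges H| = #|edges G|.
Proof.
case/isomorphicP => f [finj <- <-]; split; first exact: card_in_imset.
apply: card_in_imset => e e' /edge_sub/andP[eV _] /edge_sub/andP[e'V _].
exact: (imset_inj_on finj).
Qed.

Definition copies (T U : finType) (F : graph T) (S : {set U}) : {set graph U} :=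
  [set H : graph U | isomorphic F H & vertices H == S].

Lemma exists_bijection_on (T U : finType) (S : {set T}) (S' : {set U}) :
  (0 < #|S|)%N -> #|S| = #|S'| ->
  exists f : T -> U, {in S &, injective f} /\ f @: S = S'.
Proof.
move=> S0 SS'; have /card_gt0P[u0 _] : (0 < #|S'|)%N by rewrite -SS'.
pose f t := nth u0 (enum S') (index t (enum S)).
have sz t : t \in S -> (index t (enum S) < size (enum S'))%N.
  by move=> tS; rewrite -cardE -SS' cardE index_mem mem_enum.
have finj : {in S &, injective f}.
  move=> t t' tS t'S /eqP; rewrite nth_uniq ?enum_uniq ?sz // => /eqP tt.
  have : nth t (enum S) (index t (enum S)) = nth t (enum S) (index t' (enum S)).
    by rewrite tt.
  by rewrite !nth_index ?mem_enum.
exists f; split=> //; apply/eqP; rewrite eqEcard card_in_imset // SS' leqnn andbT.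
apply/fintype.subsetP => _ /imsetP[t tS ->].
by rewrite -mem_enum mem_nth ?sz.
Qed.

Lemma card_copies_le (T U U' : finType) (F : graph T) (S : {set U}) (S' : {set U'}) :
  (0 < #|S|)%N -> #|S| = #|S'| -> (#|copies F S| <= #|copies F S'|)%N.
Proof.
move=> S0 SS'; have [f [finj fS]] := exists_bijection_on S0 SS'.
have g0 : is_graph (finset.set0 : {set U'}, finset.set0 : {set {set U'}}).
  by apply/forall_inP => e; rewrite inE.
pose im (H : graph U) : {set U'} * {set {set U'}} :=
  (S', [set f @: (e : {set U}) | e in edges H]).
(* The empty graph is only a default for [H] outside [copies F S], where [im H] need not be a
   graph. *)
pose phi (H : graph U) : graph U' := insubd (Graph g0) (im H).
have phiE H : H \in copies F S -> val (phi H) = im H.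
  rewrite inE => /andP[_ /eqP HS]; rewrite /phi insubdK // unfold_in.
  apply/forall_inP => _ /imsetP[e /edge_sub/andP[+ e2] ->]; rewrite HS => eS.
  rewrite /= -{1}fS imsetS //= card_in_imset // => u v ue ve.
  by apply: finj; apply: (fintype.subsetP eS).
rewrite -(@card_in_imset _ _ phi); last first.
  move=> H H' HS H'S eqH.
  have := congr1 val eqH; rewrite !phiE // => -[eqE].
  move: HS H'S; rewrite !inE => /andP[_ /eqP HS] /andP[_ /eqP H'S].
  apply: graph_eq; first by rewrite HS H'S.
  apply: (@imset_inj_on _ _ (fun e : {set U} => f @: e) (powerset S)) => //.
  - by move=> e e'; rewrite !inE; apply: imset_inj_on.
  - apply/fintype.subsetP => e /edge_sub/andP[]; rewrite HS inE => ->.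
    by [].
  - apply/fintype.subsetP => e /edge_sub/andP[]; rewrite H'S inE => ->.
    by [].
apply: subset_leq_card; apply/fintype.subsetP => _ /imsetP[H HS ->].
have := phiE H HS; move: HS; rewrite !inE => /andP[/isomorphicP[h [hinj hV hE]]
  /eqP HS] pE.
rewrite /vertices pE eqxx andbT; apply/isomorphicP; exists (f \o h); split.
- move=> u v uF vF /= /finj fh; apply: hinj => //; apply: fh;
  by rewrite -HS -hV imset_f.
- by rewrite imset_comp hV HS fS /vertices pE.
- rewrite /edges pE /= -hE -imset_comp; apply: eq_imset => e /=.
  by rewrite imset_comp.
Qed.

(** Makes the number of labels per vertex set a constant of [F], the same for all [n]. *)
Lemma card_copies (T U : finType) (F : graph T) (S : {set U}) :
  (0 < #|vertices F|)%N -> #|S| = #|vertices F| ->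
  #|copies F S| = #|copies F (vertices F)|.
Proof.
move=> F0 SF; apply/eqP; rewrite eqn_leq; apply/andP.
by split; apply: card_copies_le; rewrite ?SF.
Qed.

(* The common part of two distinct copies of F is, pulled back along an
   isomorphism, a proper subgraph of F. *)
Lemma overlap_sparse (T U : finType) (F : graph T) (H H' : graph U) :
  (2 <= #|vertices F|)%N ->
  strictly_1_balanced F -> isomorphic F H -> isomorphic F H' -> H' != H ->
  ~~ [disjoint edges H' & edges H] ->
  (#|edges H' :&: edges H| * #|vertices F|.-1 <
   #|edges F| * #|vertices H' :&: vertices H|.-1)%N.
Proof.
move=> F2 bal isoH isoH' HH' shared.
have [cV cE] := isomorphic_card isoH; have [cV' cE'] := isomorphic_card isoH'.
have [f [finj fV fE]] := isomorphicP _ _ isoH.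
pose A := [set v in vertices F | f v \in vertices H'].
pose B := [set e in edges F | f @: (e : {set T}) \in edges H'].
have gAB : is_graph (A, B).
  apply/forall_inP => e; rewrite inE /= => /andP[eF eH'].
  have /andP[eV ->] := edge_sub eF; rewrite andbT.
  have /andP[eV' _] := edge_sub eH'.
  apply/fintype.subsetP => v ve; rewrite inE (fintype.subsetP eV) //=.
  by apply: (fintype.subsetP eV'); rewrite imset_f.
pose F' := Graph gAB.
have VF' : vertices F' = A by [].
have EF' : edges F' = B by [].
have cA : #|vertices H' :&: vertices H| = #|A|.
  rewrite -(@card_in_imset _ _ f A); last first.
    by move=> u v; rewrite !inE => /andP[uF _] /andP[vF _]; apply: finj.
  apply: eq_card => w; rewrite inE -fV; apply/andP/imsetP => [[wH' /imsetP[v vF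
    wv]]|[v + ->]].
    by exists v; rewrite // inE vF -wv.
  by rewrite inE => /andP[vF vH']; split=> //; rewrite imset_f.
have cB : #|edges H' :&: edges H| = #|B|.
  rewrite -(@card_in_imset _ _ (fun e : {set T} => f @: e) B); last first.
    move=> e e'; rewrite !inE => /andP[/edge_sub/andP[eV _] _]
      /andP[/edge_sub/andP[eV' _] _].
    exact: (imset_inj_on finj).
  apply: eq_card => w; rewrite inE -fE; apply/andP/imsetP => [[wH' /imsetP[v vF
    wv]]|[v + ->]].
    by exists v; rewrite // inE vF -wv.
  rewrite inE => /andP[vF vH']; split=> //.
  exact: (imset_f (fun e : {set T} => f @: e)).
have subF : subgraph F' F.
  by apply/andP; split; apply/fintype.subsetP => x; rewrite inE => /andP[].
have neF : F' != F.
  apply: contra HH' => /eqP eqF; apply/eqP; apply: graph_eq.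
    apply/eqP; rewrite eq_sym eqEcard cV cV' leqnn andbT.
    apply/finset.setIidPr/eqP; rewrite eqEcard finset.subsetIr cA -VF' eqF cV leqnn.
    by [].
  apply/eqP; rewrite eq_sym eqEcard cE cE' leqnn andbT.
  apply/finset.setIidPr/eqP; rewrite eqEcard finset.subsetIr cB -EF' eqF cE leqnn.
  by [].
have A2 : (2 <= #|A|)%N.
  move: shared; rewrite -setI_eq0 => /finset.set0Pn[e]; rewrite inE => /andP[eH' eH].
  have /andP[eV /eqP <-] := edge_sub eH; have /andP[eV' _] := edge_sub eH'.
  by rewrite -cA; apply: subset_leq_card; rewrite finset.subsetI eV eV'.
have := bal F' subF neF A2; rewrite /d1 VF' EF' cA cB.
have A1 : (0 < #|A|.-1)%N by case: #|A| A2 => [|[]].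
have F1 : (0 < #|vertices F|.-1)%N by case: #|vertices F| F2 => [|[]].
rewrite ltr_pdivrMr ?ltr0n // mulrAC ltr_pdivlMr ?ltr0n //.
by rewrite -!natrM ltr_nat.
Qed.

(** * Copies as labelled vertex sets *)

Section CopyIndex.
Variables (T : finType) (F : graph T) (n : nat).
Hypothesis F2 : (2 <= #|vertices F|)%N.

Definition copy : finType := {H : graph 'I_n | isomorphic F H}.

Local Notation b := #|copies F (vertices F)|.
Local Notation U := 'I_n.

Definition copy_vertices (j : copy) : {set U} := vertices (val j).
Definition copy_edges (j : copy) : {set {set U}} := edges (val j).

Lemma copy_card (j : copy) :
  #|copy_vertices j| = #|vertices F| /\ #|copy_edges j| = #|edges F|.
Proof. by have /isomorphic_card := valP j. Qed.

Lemma card_copies_copy (j : copy) : #|copies F (copy_vertices j)| = b.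
Proof. by rewrite card_copies ?(ltnW F2) //; case: (copy_card j). Qed.

Lemma index_copy (j : copy) :
  (index (val j) (enum (copies F (copy_vertices j))) < b)%N.
Proof.
rewrite -(card_copies_copy j) cardE index_mem mem_enum inE eqxx andbT.
exact: valP.
Qed.

(** The label is the rank of the copy among those on the same vertex set, so that copies correspond
    bijectively to labelled sets of size [#|vertices F|]. *)
Definition copy_lab (j : copy) : lab b U :=
  (copy_vertices j, Ordinal (index_copy j)).

Lemma copy_lab_inj : injective copy_lab.
Proof.
move=> j j' [VV II]; apply: val_inj.
have jc (i : copy) : val i \in enum (copies F (copy_vertices i)).
  by rewrite mem_enum inE eqxx andbT; apply: valP.
by rewrite -(nth_index (val j) (jc j)) II VV; apply: nth_index; apply: jc.
Qed.

Lemma copy_lab_surj (E : {set U}) k : #|E| = #|vertices F| ->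
  exists j, copy_lab j = (E, k).
Proof.
move=> EF; have cb : #|copies F E| = b by apply: card_copies; rewrite // ltnW.
have kE : (k < size (enum (copies F E)))%N by rewrite -cardE cb.
have H0 : graph U.
  by case: (enum (copies F E)) kE => // H *; exact: H.
have := mem_nth H0 kE; rewrite mem_enum inE => /andP[isoH /eqP VH].
exists (exist (fun H : graph U => is_true (isomorphic F H)) _ isoH); rewrite
  /copy_lab; congr pair; first exact: VH.
apply: val_inj; rewrite /= /copy_vertices /= VH index_uniq ?enum_uniq //.
Qed.

Lemma Ex_copy (R : realType) r' (q : R) (psi : nat -> R) :
  #|vertices F| = r'.+2 ->
  Ex (fun j : copy => q) (fun Y => psi (minmono copy_vertices Y)) =
  Ex (@lab_prob R b r' U q) (fun Y => psi (minmono (fun j : lab b U => j.1) Y)).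
Proof.
move=> Fr.
have -> : Ex (fun j : copy => q) (fun Y => psi (minmono copy_vertices Y)) =
    Ex (@lab_prob R b r' U q \o copy_lab) (fun Y => psi (minmono copy_vertices Y)).
  congr Ex; apply/funext => j; rewrite /= /lab_prob /=.
  by have [-> _] := copy_card j; rewrite Fr eqxx.
rewrite -(Ex_preim _ (fun Y => psi (minmono copy_vertices Y)) copy_lab_inj).
apply: eq_ExP => Y Yr; congr (psi _).
have costE A : cost copy_vertices (copy_lab @^-1: Y) A =
    cost (fun j : lab b U => j.1) Y A.
  rewrite /cost -(card_imset _ copy_lab_inj); apply: eq_card => -[E k].
  rewrite !inE; apply/imsetP/andP => [[j + ->]|[EY mE]].
    by rewrite !inE => /andP[].
  have /copy_lab_surj H : #|E| = #|vertices F|.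
    rewrite Fr; apply/eqP; move: (Yr _ EY); rewrite /lab_prob /=.
    by case: ifP => //; rewrite eqxx.
  by have [j jE] := H k; exists j; rewrite // !inE jE EY /=; have -> :
    copy_vertices j = E := congr1 fst jE.
apply/eqP; rewrite eqn_leq; apply/andP; split.
  have [A /eqP <-] := minmono_opt (fun j : lab b U => j.1) Y.
  by rewrite -costE minmono_le.
have [A /eqP <-] := minmono_opt copy_vertices (copy_lab @^-1: Y).
by rewrite costE minmono_le.
Qed.

End CopyIndex.

(** * The random graph *)

Section RandomGraph.
Variables (R : realType) (n : nat).

(** Every vertex set is a coordinate, non-pairs with probability 0, so that edge sets range over a
    full product space. *)
Definition pair_prob (p : R) (e : {set 'I_n}) : R := if #|e| == 2%N then p else 0.

Lemma gnp_Ex (p : R) (h : {set {set 'I_n}} -> R) :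
  \sum_(G : graph 'I_n) gnp p G * h (edges G) = Ex (pair_prob p) h.
Proof.
pose pairs : {set {set 'I_n}} := [set e : {set 'I_n} | #|e| == 2%N]%SET.
have gP (E : {set {set 'I_n}}) : is_graph ([set: 'I_n]%SET, E :&: pairs).
  by apply/forall_inP => e /=; rewrite !inE finset.subsetT => /andP[].
rewrite (bigID (fun G : graph 'I_n => vertices G == [set: 'I_n]%SET)) /=.
rewrite [X in _ + X]big1 ?addr0; last first.
  by move=> G /negPf VG; rewrite /gnp VG mul0r.
rewrite (reindex_onto (fun E => Graph (gP E)) (@edges _)) /=; last first.
  move=> G /eqP VG; apply: graph_eq => //; rewrite /edges /=.
  apply/finset.setIidPl/fintype.subsetP => e /edge_sub/andP[_ e2].
  by rewrite inE.
rewrite /Ex [RHS](bigID (fun E : {set {set 'I_n}} => E :&: pairs == E)) /=.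
rewrite [X in _ = _ + X]big1 ?addr0; last first.
  move=> E /eqP/finset.setIidPl/fintype.subsetPn[e eE eP].
  rewrite /bern (bigD1 e) //= eE /pair_prob.
  by move: eP; rewrite inE => /negPf ->; rewrite !mul0r.
apply: eq_big => [E|E]; first by rewrite {1}/vertices /edges /= eqxx.
rewrite {1}/vertices /edges /= eqxx /= => /eqP EP.
rewrite /gnp {1}/vertices /edges /= eqxx EP; congr (_ * _).
rewrite big_mkcond; apply: eq_bigr => e _; rewrite /pair_prob.
case: ifP => // e2.
have /negPf -> : e \notin E by rewrite -EP !inE e2 andbF.
by rewrite subr0.
Qed.

Lemma gnp_vertices (p : R) (g h : graph 'I_n -> R) :
  (forall G, vertices G = [set: 'I_n]%SET -> g G = h G) ->
  \sum_(G : graph 'I_n) gnp p G * g G = \sum_(G : graph 'I_n) gnp p G * h G.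
Proof.
move=> gh; apply: eq_bigr => G _; rewrite /gnp.
by case: eqP => [/gh ->|]; rewrite ?mul0r.
Qed.

End RandomGraph.

Lemma MinM_minmono (T : finType) (F : graph T) (n : nat) (G : graph 'I_n) :
  vertices G = [set: 'I_n]%SET ->
  MinM G F = minmono (@copy_vertices T F n) (covered (@copy_edges T F n) (edges G)).
Proof.
move=> VG; set Y := covered _ _.
have numE (P : {set 'I_n} * {set 'I_n}) : is_bipartition G P ->
    num_mono G F P = cost (@copy_vertices T F n) Y P.1.
  move=> /andP[/eqP PU /eqP PI].
  have P2 : P.2 = ~: P.1.
    apply/finset.setP => v; move/finset.setP/(_ v): PU; move/finset.setP/(_ v): PI.
    by rewrite VG !inE; case: (v \in P.1) => //= ->.
  rewrite /num_mono /cost -(@card_imset (copy F n) (graph _ : finType) val _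
    val_inj); apply: eq_card => H.
  rewrite inE; apply/and3P/imsetP => [[/andP[_ HE] isoH mH]|[j + ->]].
    exists (exist (fun H : graph 'I_n => is_true (isomorphic F H)) _ isoH) => //.
    by rewrite !inE; apply/andP; split => //; rewrite /mono -P2.
  rewrite !inE => /andP[jE mj]; split.
  - by rewrite /subgraph VG finset.subsetT.
  - exact: valP.
  - by rewrite /monochromatic P2.
have bip A : is_bipartition G (A, ~: A).
  by rewrite /is_bipartition /= VG finset.setUCr finset.setICr !eqxx.
rewrite /MinM; case: arg_minnP => [|P PB Pmin].
  by rewrite /is_bipartition finset.setU0 finset.setI0 !eqxx.
rewrite numE //; apply/eqP; rewrite eqn_leq minmono_le andbT.
have [A /eqP <-] := minmono_opt (@copy_vertices T F n) Y.
by rewrite -(numE P PB) -(numE _ (bip A)); apply: Pmin.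
Qed.

(** * Copies overlapping a given copy *)

Section Overlap.
Variables (R : realType) (T : finType) (F : graph T) (n : nat).
Hypothesis F2 : (2 <= #|vertices F|)%N.
Hypothesis bal : strictly_1_balanced F.

Local Notation r := #|vertices F|.
Local Notation s := #|edges F|.
Local Notation b := #|copies F (vertices F)|.

Lemma sum_copy_le (g : lab b 'I_n -> R) : (forall l, 0 <= g l) ->
  \sum_(j : copy F n) g (copy_lab F2 j) <= \sum_l g l.
Proof.
move=> g0; rewrite (eq_bigl (mem [set: copy F n]%SET)); last by move=> j;
  exact: esym (finset.in_setT j).
rewrite -(big_imset g) /=; last by move=> i j _ _; apply: copy_lab_inj.
rewrite [leRHS](bigID (mem (copy_lab F2 @: [set: copy F n]%SET))) /=.
by rewrite lerDl; apply: sumr_ge0.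
Qed.

Lemma cover_prob_copy (p : R) (j : copy F n) :
  cover_prob (pair_prob p) (@copy_edges T F n) j = p ^+ s.
Proof.
have [_ <-] := copy_card j; rewrite /cover_prob -prodr_const; apply: eq_bigr => e eE.
by rewrite /pair_prob; have /andP[_ ->] := edge_sub eE.
Qed.

(** The sum is the product of the [w v + 1]. With weight 1 on a given copy and 1/n elsewhere it
    handles all intersection sizes at once, with no case distinction on the overlap. *)
Lemma sum_prod_weight_le (w : 'I_n -> R) : (forall v, 0 <= w v) ->
  \sum_(S : {set 'I_n}) \prod_(v in S) w v <= expR (\sum_v w v).
Proof.
move=> w0; have -> : \sum_(S : {set 'I_n}) \prod_(v in S) w v = \prod_v (w v + 1).
  by rewrite bigA_distr; apply: eq_bigr => S _; rewrite big_mkcond.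
rewrite expR_sum; apply: ler_prod => v _.
by rewrite addr_ge0 //= addrC expR_ge1Dx.
Qed.

(* With t = n^(1/s), balance in the form (r-1) e' + 1 <= s (v'-1) turns
   p^(s-e') into n^(v'-r) / t, up to a constant. *)
Lemma overlap_prob (c t : R) (j j' : copy F n) :
  0 < c -> 1 <= t -> (0 < s)%N -> (0 < n)%N -> n%:R = t ^+ s ->
  j' != j -> ~~ [disjoint copy_edges j' & copy_edges j] ->
  \prod_(e in copy_edges j' :\: copy_edges j) pair_prob (c / t ^+ r.-1) e <=
  Num.max 1 c ^+ s / t *
    \prod_(v in copy_vertices j') (if v \in copy_vertices j then 1 else n%:R^-1).
Proof.
move=> c0 t1 s0 n0 nt jj shared; set p := c / _.
have t0 : 0 < t by apply: lt_le_trans t1.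
have [cV cE] := copy_card j; have [cV' cE'] := copy_card j'.
have sparse := overlap_sparse F2 bal (valP j) (valP j') jj shared.
rewrite -/(copy_edges j) -/(copy_edges j') -/(copy_vertices j) -/(copy_vertices
  j') in sparse.
set ne := #|copy_edges j' :&: copy_edges j| in sparse.
set nv := #|copy_vertices j' :&: copy_vertices j| in sparse.
have neE : #|copy_edges j' :\: copy_edges j| = (s - ne)%N by rewrite cardsD cE'.
have nvE : #|copy_vertices j' :\: copy_vertices j| = (r - nv)%N by rewrite cardsD cV'.
have ne_s : (ne <= s)%N by rewrite -cE'; apply: subset_leq_card; apply: finset.subsetIl.
have nv_r : (nv <= r)%N by rewrite -cV'; apply: subset_leq_card; apply: finset.subsetIl.
have -> : \prod_(e in copy_edges j' :\: copy_edges j) pair_prob p e = p ^+ (s - ne).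
  rewrite -neE -prodr_const; apply: eq_bigr => e; rewrite inE => /andP[_ eE].
  by rewrite /pair_prob; have /andP[_ ->] := edge_sub eE.
have -> : \prod_(v in copy_vertices j') (if v \in copy_vertices j then 1 else n%:R^-1)
     = (n%:R ^+ (r - nv))^-1 :> R.
  rewrite -exprVn -nvE -prodr_const [LHS]big_mkcond [RHS]big_mkcond; apply:
    eq_bigr => v _.
  by rewrite inE; case: (v \in copy_vertices j); case: (v \in copy_vertices j').
rewrite /p exprMn exprVn -mulrA; apply: ler_pM.
- by rewrite exprn_ge0 // ltW.
- by rewrite invr_ge0 exprn_ge0 // exprn_ge0 // ltW.
- apply: le_trans (_ : Num.max 1 c ^+ (s - ne) <= _).
    by rewrite lerXn2r ?nnegrE ?le_max ?lexx ?orbT ?ler01 // ltW.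
  by rewrite ler_weXn2l ?leq_subr // le_max lexx.
rewrite -invfM lef_pV2 ?posrE ?mulr_gt0 ?exprn_gt0 ?ltr0n //.
rewrite nt -exprM -exprS -exprM ler_weXn2l //.
have r1 : r = r.-1.+1 by rewrite prednK // ltnW.
have nv1 : nv = nv.-1.+1.
  by rewrite prednK // lt0n; apply: contraTneq sparse => ->; rewrite muln0 ltn0.
move: sparse ne_s nv_r; rewrite r1 nv1 /=; move: r.-1 nv.-1 => a d sparse ne_s nv_r.
rewrite subSS mulnBr mulnBr [(a * s)%N]mulnC [(a * ne)%N]mulnC.
have : (s * d <= s * a)%N by rewrite leq_mul2l -ltnS nv_r orbT.
have : (ne * a <= s * a)%N by rewrite leq_mul2r ne_s orbT.
by move=> _ da; apply: ltn_sub2l => //; apply: leq_trans sparse da.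
Qed.

End Overlap.

(** * Mean deviation of the minimum in the random graph *)

Section MeanDeviation.
Variables (R : realType) (T : finType) (F : graph T) (n r' : nat).
Hypothesis F2 : (2 <= #|vertices F|)%N.
Hypothesis bal : strictly_1_balanced F.
Hypothesis Fr : #|vertices F| = r'.+2.
Hypothesis n_gt0 : (0 < n)%N.

Local Notation r := #|vertices F|.
Local Notation s := #|edges F|.
Local Notation b := #|copies F (vertices F)|.

Hypothesis s_gt0 : (0 < s)%N.

Variables (c t : R).
Hypothesis c_gt0 : 0 < c.
Hypothesis t_ge1 : 1 <= t.
Hypothesis nt : n%:R = t ^+ s.

Local Notation p := (c / t ^+ r.-1).
Local Notation q := (c ^+ s / n%:R ^+ r'.+1).
Local Notation M := (Num.max 1 c ^+ s).

Hypothesis p_le1 : p <= 1.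

Let t_gt0 : 0 < t. Proof. exact: lt_le_trans t_ge1. Qed.

Let n_gt0R : 0 < n%:R :> R. Proof. by rewrite ltr0n. Qed.

Let pq : p ^+ s = q.
Proof.
by rewrite exprMn exprVn -exprM mulnC exprM -nt Fr.
Qed.

Let p01 : 0 <= p <= 1.
Proof. by rewrite p_le1 andbT divr_ge0 ?exprn_ge0 // ltW. Qed.

Let q01 : 0 <= q <= 1.
Proof.
rewrite -pq; have /andP[p0 p1] := p01.
by rewrite exprn_ge0 //= exprn_ile1.
Qed.

(** The weights [w] add up to at most [r.+1]: 1 for each vertex of [j], and at most n times 1/n for
    the rest. The factor [b] counts the copies on one vertex set. *)
Lemma overlap_sum (j : copy F n) :
  \sum_(j' : copy F n | (j' != j) && ~~ [disjoint copy_edges j' & copy_edges j])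
     \prod_(e in copy_edges j' :\: copy_edges j) pair_prob p e <=
  M / t * (b%:R * expR (r.+1)%:R).
Proof.
pose w v : R := if v \in copy_vertices j then 1 else n%:R^-1.
have w0 v : 0 <= w v by rewrite /w; case: ifP.
have Mt0 : 0 <= M / t.
  by rewrite divr_ge0 ?(ltW t_gt0) // exprn_ge0 // le_max ler01.
apply: le_trans (_ : _ <= \sum_(j' : copy F n) M / t * \prod_(v in
  copy_vertices j') w v) _.
  rewrite big_mkcond; apply: ler_sum => j' _; case: ifP => [/andP[jj shared]|_].
    exact: overlap_prob.
  by rewrite mulr_ge0 // prodr_ge0.
rewrite -big_distrr ler_wpM2l //.
pose g (l : lab b 'I_n) : R := \prod_(v in l.1) w v.
apply: le_trans (_ : _ <= \sum_l g l) _.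
  by apply: (sum_copy_le F2 (g := g)) => l; apply: prodr_ge0.
rewrite (sum_lab b (fun S : {set 'I_n} => \prod_(v in S) w v)) ler_wpM2l //.
apply: le_trans (sum_prod_weight_le w0) _; rewrite ler_expR.
apply: le_trans (_ : \sum_v ((v \in copy_vertices j)%:R + n%:R^-1) <= _).
  by apply: ler_sum => v _; rewrite /w; case: ifP; rewrite ?lerDl ?add0r.
rewrite big_split /= sumr_const card_ord -[n%:R^-1 *+ n]mulr_natl mulfV ?gt_eqF //.
rewrite -natr1 lerD2r -natr_sum ler_nat.
have [<- _] := copy_card j; rewrite -sum1_card [leqRHS]big_mkcond.
by apply: leq_sum => v _; case: ifP.
Qed.

Lemma sum_copy_prob : \sum_(j : copy F n) q <= b%:R * c ^+ s * n%:R.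
Proof.
have /andP[q0 _] := q01.
apply: le_trans (_ : _ <= \sum_(l : lab b 'I_n) lab_prob r' q l) _.
  apply: le_trans (sum_copy_le F2 _); last by move=> l; rewrite /lab_prob; case: ifP.
  apply: ler_sum => j _; rewrite /lab_prob /=; have [-> _] := copy_card j.
  by rewrite Fr eqxx.
rewrite sum_lab_prob card_ord -!mulrA ler_wpM2l //.
rewrite mulrCA ler_wpM2l ?exprn_ge0 ?(ltW c_gt0) //.
rewrite ler_pdivrMr ?exprn_gt0 // -exprS -natrX ler_nat.
exact: bin_le_expn.
Qed.

Lemma mean_deviation (m delta : R) : 0 < delta ->
  \sum_(G : graph 'I_n) gnp p G * `|(MinM G F)%:R / n%:R - m| <=
  `|mean_min b r' 'I_n q / n%:R - m| + delta + b%:R * c ^+ s / (delta * n%:R)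
  + 2 * (b%:R * c ^+ s) * (M / t * (b%:R * expR (r.+1)%:R)).
Proof.
move=> d0; set a := mean_min _ _ _ _.
pose psi (k : nat) : R := `|k%:R / n%:R - m|.
have pp01 (e : {set 'I_n}) : 0 <= pair_prob p e <= 1.
  by rewrite /pair_prob; case: ifP => // _; rewrite lexx ler01.
pose f := @minmono _ _ (@copy_vertices T F n).
pose X := covered (@copy_edges T F n).
rewrite (@gnp_vertices _ _ p _ (fun G => psi (f (X (edges G))))); last first.
  by move=> G /MinM_minmono ->.
rewrite (gnp_Ex p (fun E => psi (f (X E)))).
have psi_lip j (Y : {set copy F n}) : `|psi (f (j |: Y)) - psi (f (Y :\ j))| <= n%:R^-1.
  rewrite /psi; apply: le_trans (ler_dist_dist _ _) _.
  rewrite opprB addrA subrK -mulrBl normrM [X in _ * X]ger0_norm ?invr_ge0 //.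
  by rewrite ler_piMl ?invr_ge0 // minmono_lipschitz.
have cmp := covered_compare (@copy_edges T F n) pp01 (g := fun Y => psi (f Y)) psi_lip.
have cq : cover_prob (pair_prob p) (@copy_edges T F n) = fun=> q.
  by apply/funext => j; rewrite cover_prob_copy pq.
rewrite cq in cmp.
have exch : Ex (pair_prob p) (fun E => psi (f (X E))) <=
    Ex (fun=> q) (fun Y => psi (f Y)) +
    2 * (b%:R * c ^+ s) * (M / t * (b%:R * expR (r.+1)%:R)).
  rewrite -lerBlDl; apply: le_trans (ler_norm _) _; apply: le_trans cmp _.
  set K := M / t * _.
  have K0 : 0 <= K.
    rewrite mulr_ge0 ?mulr_ge0 ?expR_ge0 ?invr_ge0 ?(ltW t_gt0) //.
    by rewrite exprn_ge0 // le_max ler01.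
  have /andP[q0 _] := q01.
  apply: le_trans (_ : _ <= \sum_(j : copy F n) q * (2 * n%:R^-1 * K)) _.
    apply: ler_sum => j _; rewrite ler_wpM2l // ler_wpM2l //.
    exact: overlap_sum.
  rewrite -big_distrl /=.
  apply: le_trans (_ : _ <= b%:R * c ^+ s * n%:R * (2 * n%:R^-1 * K)) _.
    by rewrite ler_wpM2r ?sum_copy_prob // mulr_ge0 // mulr_ge0 // invr_ge0.
  have id (x z k : R) : z != 0 -> x * z * (2 * z^-1 * k) = 2 * x * k.
    by move=> z0; field.
  by rewrite id ?gt_eqF.
apply: le_trans exch _; rewrite lerD2r.
have aE : a = Ex (fun=> q) (fun Y => (f Y)%:R).
  by rewrite /f (@Ex_copy _ F n F2 R r' q (fun k => k%:R) Fr).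
have qq01 (j : copy F n) : 0 <= q <= 1 by [].
have var := efron_stein qq01 (g := fun Y => (f Y)%:R)
  (fun j Y => minmono_lipschitz (@copy_vertices T F n) R Y j).
rewrite -/f -aE in var.
have dn0 : 0 < delta * n%:R ^+ 2 by rewrite mulr_gt0 ?exprn_gt0.
(* The inequality [z <= delta + z ^+ 2 / delta] bounds the mean fluctuation by the variance without
   a square root. *)
apply: le_trans (_ : _ <= Ex (fun=> q) (fun Y : {set copy F n} =>
   (`|a / n%:R - m| + delta) + (delta * n%:R ^+ 2)^-1 * ((f Y)%:R - a) ^+ 2)) _.
  apply: (Ex_le qq01) => Y; rewrite /psi.
  have -> : (f Y)%:R / n%:R - m = (a / n%:R - m) + ((f Y)%:R - a) / n%:R.
    by rewrite mulrBl; ring.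
  apply: le_trans (ler_normD _ _) _; rewrite -[leRHS]addrA lerD2l.
  have -> : (delta * n%:R ^+ 2)^-1 * ((f Y)%:R - a) ^+ 2 =
     `|((f Y)%:R - a) / n%:R| ^+ 2 / delta.
    rewrite real_normK ?num_real //.
    have id (x z d : R) : z != 0 -> d != 0 -> (d * z ^+ 2)^-1 * x ^+ 2 = (x /
      z) ^+ 2 / d.
      by move=> z0 d_neq0; field; rewrite ?z0 ?d_neq0.
    by apply: id; rewrite gt_eqF.
  set z := `|_ / _|; have z0 : 0 <= z by apply: normr_ge0.
  have [zd|dz] := lerP z delta; first by apply: le_trans zd _; rewrite lerDl
    divr_ge0 ?sqr_ge0 ?ltW.
  apply: le_trans (_ : z ^+ 2 / delta <= _); last by rewrite lerDr ltW.
  by rewrite ler_pdivlMr // expr2 ler_wpM2l // ltW.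
rewrite ExD Ex_const ExZ lerD2l.
apply: le_trans (_ : (delta * n%:R ^+ 2)^-1 * (b%:R * c ^+ s * n%:R) <= _).
  rewrite ler_wpM2l ?invr_ge0 ?(ltW dn0) //.
  exact: le_trans var sum_copy_prob.
have id (x z d : R) : z != 0 -> d != 0 -> (d * z ^+ 2)^-1 * (x * z) = x / (d * z).
  by move=> z0 d_neq0; field; rewrite ?z0 ?d_neq0.
by rewrite id ?gt_eqF.
Qed.

End MeanDeviation.

(** * From means to convergence in probability *)

Lemma edge_probE (R : realType) (T : finType) (F : graph T) (c : R) (n : nat) :
  (0 < n)%N -> (0 < #|edges F|)%N -> (2 <= #|vertices F|)%N ->
  edge_prob F c n = c / (n%:R `^ (#|edges F|%:R^-1)) ^+ #|vertices F|.-1.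
Proof.
move=> n0 s0 r2; rewrite /edge_prob powRN; congr (_ / _).
rewrite -powR_mulrn ?powR_ge0 // -powRrM; congr (_ `^ _).
rewrite /d1 rmorphM /= fmorphV /= !ratr_nat div1r invfM invrK mulrC.
by rewrite mulrC.
Qed.

Lemma gnp_markov (R : realType) (n : nat) (p eps : R) (X : graph 'I_n -> R) :
  0 <= p <= 1 -> 0 < eps ->
  eps * gnp_prob p (fun G => eps <= `|X G|) <= \sum_(G : graph 'I_n) gnp p G * `|X G|.
Proof.
move=> p01 eps0; rewrite /gnp_prob big_distrr big_mkcond /=; apply: ler_sum => G _.
have g0 : 0 <= gnp p G by apply: gnp_ge0.
case: ifP => [XG|_]; last by rewrite mulr_ge0.
by rewrite mulrC ler_wpM2l.
Qed.

Section Root.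
Variables (R : realType) (s : nat).
Hypothesis s_gt0 : (0 < s)%N.

Definition nth_root (n : nat) : R := n%:R `^ (s%:R^-1).

Lemma nth_rootX n : nth_root n ^+ s = n%:R.
Proof.
rewrite /nth_root -powR_mulrn ?powR_ge0 // -powRrM mulVf ?pnatr_eq0 -?lt0n //.
by rewrite powRr1.
Qed.

Lemma nth_root_ge B n : (B ^ s <= n)%N -> B%:R <= nth_root n.
Proof.
by move=> Bn; rewrite -(@ler_pXn2r _ s) ?nnegrE ?powR_ge0 // nth_rootX -natrX ler_nat.
Qed.

End Root.

Local Open Scope classical_set_scope.

Theorem theorem1p1 (R : realType) (T : finType) (F : graph T) (r s : nat)
    (hr : #|vertices F| = r) (hs : #|edges F| = s)
    (r_ge2 : (2 <= r)%N) (s_gt0 : (0 < s)%N)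
    (F_balanced : strictly_1_balanced F)
    (c : R) (c_gt0 : 0 < c) :
  let p := fun n : nat => edge_prob F c n in
  (forall n : nat, (0 < n)%N -> p n ^+ s = c ^+ s * n%:R `^ (1 - r%:R)) /\
  exists m : R, forall eps : R, 0 < eps ->
    (fun n : nat => gnp_prob (p n)
       (fun G : graph 'I_n => eps <= `|(MinM G F)%:R / n%:R - m|))
      @ \oo --> (0 : R).
Proof.
have [r' rr'] : exists r', r = r'.+2.
  by case: r r_ge2 {hr} => [|[|r']] // _; exists r'.
have F2 : (2 <= #|vertices F|)%N by rewrite hr.
have E0 : (0 < #|edges F|)%N by rewrite hs.
have Fr : #|vertices F| = r'.+2 by rewrite hr.
move=> p.
have pE n : (0 < n)%N -> p n = c / nth_root R #|edges F| n ^+ #|vertices F|.-1.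
  by move=> n0; rewrite /p edge_probE.
split=> [n n0|].
  rewrite pE // exprMn exprVn -exprM mulnC exprM -hs nth_rootX // hr rr' /=.
  congr (_ * _); have -> : 1 - r'.+2%:R = - (r'.+1%:R) :> R.
    by rewrite -natr1 opprD addrC addrNK.
  by rewrite powR_invn.
set s' := #|edges F| in E0 pE *.
pose b := #|copies F (vertices F)|.
have [m Hm] := mean_min_limit b r' (exprn_gt0 s' c_gt0).
exists m => eps eps0; apply/cvgrPdist_le => e e0.
(* Markov's inequality brings the factor [eps], and [mean_deviation] has four terms, each made at
   most [d]. *)
pose d := eps * e / 4.
have d0 : 0 < d by rewrite /d divr_gt0 // mulr_gt0.
pose K := 2 * (b%:R * c ^+ s') * (Num.max 1 c ^+ s' * (b%:R * expR (#|vertices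
  F|.+1)%:R)).
have [N1 HN1] := Hm d d0.
have [N2 HN2] := archimedean_nat (b%:R * c ^+ s' / (d * d)).
have [B1 HB1] := archimedean_nat c.
have [B2 HB2] := archimedean_nat (K / d).
(* The power of [B1 + B2] forces [t >= B1 + B2], where [B1] gives [p n <= 1] and [B2] gives
   [K / t <= d] for the exchange error; the successor makes [n] positive. *)
exists (N1 + N2 + (B1 + B2) ^ s').+1 => // n /= Nn.
have n0 : (0 < n)%N by apply: leq_ltn_trans Nn.
have N1n : (N1 <= n)%N by lia.
have N2n : (N2 <= n)%N by lia.
have Bn : ((B1 + B2) ^ s' <= n)%N by lia.
have n0R : 0 < n%:R :> R by rewrite ltr0n.
pose t := nth_root R s' n.
have t1 : 1 <= t by rewrite -[leLHS]/(1%:R) nth_root_ge // exp1n.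
have tB : B1%:R + B2%:R <= t by rewrite -natrD nth_root_ge.
have tc : c <= t by apply: le_trans tB; rewrite (le_trans HB1) // lerDl.
have tK : K / d <= t by apply: le_trans tB; rewrite (le_trans HB2) // lerDr.
have nt : n%:R = t ^+ s' by rewrite nth_rootX.
have t0 : 0 < t by apply: lt_le_trans t1.
have p1 : c / t ^+ #|vertices F|.-1 <= 1.
  rewrite ler_pdivrMr ?exprn_gt0 // mul1r Fr /=; apply: le_trans tc _.
  by rewrite exprS ler_peMr ?exprn_ege1 // ltW.
have p01 : 0 <= p n <= 1.
  by rewrite pE // p1 andbT divr_ge0 ?exprn_ge0 // ltW.
have prob0 A : 0 <= @gnp_prob R n (p n) A.
  by apply: sumr_ge0 => G _; apply: gnp_ge0.
rewrite sub0r normrN ger0_norm // -(ler_pM2l eps0).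
apply: le_trans (gnp_markov (fun G => (MinM G F)%:R / n%:R - m) p01 eps0) _.
rewrite pE //.
apply: le_trans (mean_deviation F2 F_balanced Fr n0 E0 c_gt0 t1 nt p1 m d0) _.
rewrite -/s' -/b.
have -> : eps * e = d + d + d + d by rewrite /d; field.
apply: lerD; [apply: lerD; [apply: lerD => //; exact: HN1|]|].
  rewrite ler_pdivrMr ?mulr_gt0 // mulrA [leRHS]mulrC -ler_pdivrMr ?mulr_gt0 //.
  by apply: le_trans HN2 _; rewrite ler_nat.
have -> : 2 * (b%:R * c ^+ s') *
    (Num.max 1 c ^+ s' / t * (b%:R * expR (#|vertices F|.+1)%:R)) = K / t.
  by rewrite /K -!mulrA; congr (_ * (_ * (_ * (_ * _)))); rewrite mulrC -!mulrA.
by rewrite ler_pdivrMr // mulrC -ler_pdivrMr.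
Qed.
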